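(* Let $\lambda$ and $\mu$ be partitions written in Frobenius notation as $\lambda=(\alpha_1,\dots,\alpha_p|\beta_1,\dots,\beta_p)$ and $\mu=(\gamma_1,\dots,\gamma_q|\delta_1,\dots,\delta_q)$. Then $$s_{\lambda/\mu}=(-1)^q\det\begin{pmatrix}A&B\\C&O\end{pmatrix},$$ where $O$ is the $q\times q$ zero matrix and $$A=\Bigl(s_{(\alpha_i,\gamma_1,\dots,\gamma_q|\beta_j,\delta_1,\dots,\delta_q)/\mu}\Bigr)_{1\le i,j\le p},$$ $$B=\Bigl(s_{(\alpha_i,\gamma_1,\dots,\widehat{\gamma_j},\dots,\gamma_q|\delta_1,\dots,\delta_q)/\mu}\Bigr)_{1\le i\le p,\ 1\le j\le q},$$ $$C=\Bigl(s_{(\gamma_1,\dots,\gamma_q|\beta_j,\delta_1,\dots,\widehat{\delta_i},\dots,\delta_q)/\mu}\Bigr)_{1\le i\le q,\ 1\le j\le p}.$$ Here $\widehat{a}$ means that $a$ is removed from the sequence.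
   Context: For a partition $\lambda$ with conjugate $\lambda'$ (so $\lambda'_i$ is the number of cells in the $i$th column of its Young diagram), put $p(\lambda)=\#\{i:\lambda_i\ge i\}$, $\alpha_i=\lambda_i-i$ and $\beta_i=\lambda'_i-i$ for $1\le i\le p(\lambda)$. The Frobenius notation of $\lambda$ is $\lambda=(\alpha_1,\dots,\alpha_{p(\lambda)}|\beta_1,\dots,\beta_{p(\lambda)})$. In particular, for nonnegative integers $a,b$, $(a|b)$ is the hook partition $(a+1,1^b)$. $s_{\lambda/\mu}$ is the skew Schur symmetric function (equal to $0$ unless $\lambda_i\ge\mu_i$ for all $i$), $s_\lambda=s_{\lambda/\emptyset}$; $h_k$ and $e_k$ are the complete and elementary symmetric functions, with $h_0=e_0=1$ and $h_k=e_k=0$ for $k<0$. Extended notation: for nonnegative integer sequences $a=(a_1,\dots,a_N)$ and $b=(b_1,\dots,b_N)$ of the same length $N$ (not necessarily decreasing, possibly with repeated entries) and a partition $\mu=(\gamma_1,\dots,\gamma_q|\delta_1,\dots,\delta_q)$ in Frobenius notation, define $$s_{(a|b)/\mu}=(-1)^q\det\begin{pmatrix}\bigl(s_{(a_i|b_j)}\bigr)_{1\le i,j\le N}&\bigl(h_{a_i-\gamma_j}\bigr)_{1\le i\le N,\,1\le j\le q}\\ \bigl(e_{b_j-\delta_i}\bigr)_{1\le i\le q,\,1\le j\le N}&O\end{pmatrix},$$ where $s_{(a_i|b_j)}$ is the Schur function of the hook partition $(a_i|b_j)$ and $O$ is the $q\times q$ zero matrix. (By the Lascoux–Pragacz formula,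 when $(a|b)$ is the Frobenius notation of a partition $\nu$, this agrees with $s_{\nu/\mu}$; it is alternating in the entries of $a$ and in the entries of $b$.) *)

(* Defs.v *)
From mathcomp Require Import all_boot all_order all_algebra.
From mathcomp Require Import mpoly.

Set Implicit Arguments.
Unset Strict Implicit.
Unset Printing Implicit Defensive.

Import GRing.Theory.
Local Open Scope ring_scope.

(* Parts and columns are indexed from 0: [nth 0 la i] is the part usually
   written lambda_(i+1), and [conj_part la j] is lambda'_(j+1). *)
Definition is_partition (la : seq nat) : bool :=
  sorted geq la && (0 \notin la)%N.

Definition conj_part (la : seq nat) (j : nat) : nat :=
  count (fun r => j < r)%N la.

Definition durfee (la : seq nat) : nat :=
  count (fun i => i < nth 0 la i)%N (iota 0 (size la)).

(* For [i < durfee la] the truncated subtractions below are exact. *)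
Definition frob_arms (la : seq nat) : seq nat :=
  mkseq (fun i => nth 0 la i - i.+1)%N (durfee la).

Definition frob_legs (la : seq nat) : seq nat :=
  mkseq (fun i => conj_part la i - i.+1)%N (durfee la).

Definition hook (a b : nat) : seq nat := a.+1 :: nseq b 1%N.

Definition part_incl (mu la : seq nat) : bool :=
  all (fun i => nth 0 mu i <= nth 0 la i)%N (iota 0 (size mu)).

(* Symmetric functions are represented by their images in the polynomial rings
   in x_0, ..., x_(n-1), for all n: an element of the ring of symmetric
   functions over the integers is the compatible family of these images, with
   componentwise operations and equality. *)

(* Cells of the skew diagram la/mu, as (row, column); the column bound is the
   largest part of la. *)
Definition skew_cell (la mu : seq nat) : finType :=
  {c : 'I_(size la) * 'I_(head 0%N la) |
    (nth 0 mu c.1 <= c.2 < nth 0 la c.1)%N}.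

Definition cell_row (la mu : seq nat) (c : skew_cell la mu) : nat :=
  (val c).1.
Definition cell_col (la mu : seq nat) (c : skew_cell la mu) : nat :=
  (val c).2.

Definition semistandard (n : nat) (la mu : seq nat)
    (T : {ffun skew_cell la mu -> 'I_n}) : bool :=
  [forall c, forall d,
    ((cell_row c == cell_row d) && (cell_col c < cell_col d)%N
       ==> (T c <= T d)%N) &&
    ((cell_col c == cell_col d) && (cell_row c < cell_row d)%N
       ==> (T c < T d)%N)].

Definition skew_schur (n : nat) (la mu : seq nat) : {mpoly int[n]} :=
  if part_incl mu la then
    \sum_(T : {ffun skew_cell la mu -> 'I_n} | semistandard T)
      \prod_(c : skew_cell la mu) 'X_(T c)
  else 0.

Definition schur (n : nat) (la : seq nat) : {mpoly int[n]} :=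
  skew_schur n la [::].

Definition hsym (n : nat) (k : int) : {mpoly int[n]} :=
  if k is Posz d then
    \sum_(m : 'X_{1..n < d.+1} | mdeg m == d) 'X_[m]
  else 0.

Definition esym (n : nat) (k : int) : {mpoly int[n]} :=
  if k is Posz d then mesym n int d else 0.

(* The extended skew Schur function s_((a|b)/mu), meant for sequences a and b
   of the same length. *)
Definition ext_schur (n : nat) (a b mu : seq nat) : {mpoly int[n]} :=
  let N := size a in
  let q := durfee mu in
  (-1) ^+ q * \det (block_mx
    (\matrix_(i < N, j < N) schur n (hook (nth 0%N a i) (nth 0%N b j)))
    (\matrix_(i < N, j < q)
       hsym n ((nth 0%N a i)%:Z - (nth 0%N (frob_arms mu) j)%:Z))
    (\matrix_(i < q, j < N)
       esym n ((nth 0%N b j)%:Z - (nth 0%N (frob_legs mu) i)%:Z))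
    (0 : 'M_q)).

Definition del_nth (s : seq nat) (j : nat) : seq nat :=
  take j s ++ drop j.+1 s.

(* Main.v *)
Require Import Defs.
From mathcomp Require Import all_boot all_order all_algebra.
From mathcomp Require Import mpoly.
From mathcomp Require Import zify ring.

Set Implicit Arguments.
Unset Strict Implicit.
Unset Printing Implicit Defensive.

Import GRing.Theory.
Local Open Scope ring_scope.

(** Write alpha, beta for the arms and legs of la, and gamma, delta for those of
    mu. Let S be the matrix function of hook Schur functions, H that of the
    complete functions h_(a - gamma_j) and E that of the elementary functions
    e_(b - delta_i). The extended function s_((a|b)/mu) is [lpdet] at (a, b): up
    to the sign (-1)^q, the determinant of the block matrix with blocks S(a, b),
    H(a), E(b) and 0. The theorem follows from two facts.

    First, the skew Schur function of la/mu, a sum over tableaux, is [lpdet] at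
    (alpha, beta); this is [skew_schur_lpdet], the Lascoux-Pragacz formula. For
    a hook and the empty partition it says that the hook Schur functions are the
    entries S ([schur_hookE]), so that [ext_schur] is [lpdet] too. The formula
    is reached through the Jacobi-Trudi determinant. Splitting off the largest
    letter of the tableaux gives the same recursion as peeling one variable off
    the determinant row by row ([gschurS], [jtdetS]), hence equality
    ([gschur_jtdet]). Up to sign, the Jacobi-Trudi determinant is then what is
    left of that of a large bordered Toeplitz matrix after expansion along unit
    rows and columns, because t -> -1 - t takes the negative row indices to the
    complement of the legs ([skips_frob_legs]); eliminating the Toeplitz block, whose inverse
    consists of signed elementary functions, leaves instead the block matrix in
    S, H, E ([ndet_nblock_lpdet]).

    Second, bordering by mu leaves [lpdet] unchanged ([bordered_lpdet]); this is
    linear algebra, valid for arbitrary S, H and E as soon as H(gamma) and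
    E(delta) have determinant 1, which holds here because both are unitriangular.
    Let K be the matrix with blocks S(gamma, delta), H(gamma), E(delta), 0.
    An entry of A is det K bordered by one row and one column, hence a
    Schur complement of K; entries of B and C are K with one row or column
    replaced, hence coordinates in the bases H(gamma) and E(delta) by Cramer's
    rule. The matrix with blocks A, B, C, 0 is therefore a product of the one
    with blocks S(alpha, beta), H(alpha), E(beta), 0 with block triangular
    matrices whose determinants cancel. *)

(** * Determinants indexed by natural numbers *)

(** Entries are given by a function on nat, so that sizes such as
    (p + q) + q and p + (q + q) can be exchanged without casts. *)
Definition ndet (R : comNzRingType) (m : nat) (F : nat -> nat -> R) : R :=
  \det (\matrix_(i < m, j < m) F i j).

Lemma eq_ndet (R : comNzRingType) m (F G : nat -> nat -> R) :
  (forall i j, (i < m)%N -> (j < m)%N -> F i j = G i j) -> ndet m F = ndet m G.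
Proof. by move=> FG; congr (\det _); apply/matrixP=> i j; rewrite !mxE FG. Qed.

Definition nblock (R : comNzRingType) (p p' : nat) (A B C D : nat -> nat -> R) :=
  fun i j => if (i < p)%N then (if (j < p')%N then A i j else B i (j - p')%N)
             else (if (j < p')%N then C (i - p)%N j else D (i - p)%N (j - p')%N).

Lemma nblock_mx (R : comNzRingType) (p q p' q' : nat) (A B C D : nat -> nat -> R) :
  \matrix_(i < p + q, j < p' + q') nblock p p' A B C D i j =
  block_mx (\matrix_(i, j) A i j) (\matrix_(i, j) B i j)
           (\matrix_(i, j) C i j) (\matrix_(i, j) D i j).
Proof.
apply/matrixP=> i j; rewrite !mxE.
case: (splitP i) => i' Hi; rewrite !mxE; case: (splitP j) => j' Hj;
  rewrite !mxE /nblock Hi Hj ?ltn_ord ?ltnNge ?leq_addr ?addKn //=.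
Qed.

Lemma ndet_block (R : comNzRingType) (p q : nat) (A B C D : nat -> nat -> R) :
  ndet (p + q) (nblock p p A B C D) =
  \det (block_mx (\matrix_(i < p, j < p) A i j) (\matrix_(i < p, j < q) B i j)
                 (\matrix_(i < q, j < p) C i j) (\matrix_(i < q, j < q) D i j)).
Proof. by rewrite -nblock_mx. Qed.

Lemma ndet_unit_col (R : comNzRingType) (m r c : nat) (F : nat -> nat -> R) :
  (r < m.+1)%N -> (c < m.+1)%N ->
  (forall i, (i < m.+1)%N -> F i c = (i == r)%:R) ->
  ndet m.+1 F = (-1) ^+ (r + c) * ndet m (fun i j => F (bump r i) (bump c j)).
Proof.
move=> rm cm Fc; rewrite /ndet (expand_det_col _ (Ordinal cm)).
rewrite (bigD1 (Ordinal rm)) //= big1 => [|i ir].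
  rewrite mxE Fc ?eqxx // addr0 mul1r /cofactor /=; congr (_ * \det _).
  by apply/matrixP=> i j; rewrite !mxE.
by rewrite mxE Fc // -(inj_eq val_inj) in ir *; rewrite (negPf ir) mul0r.
Qed.

Lemma ndet_tr (R : comNzRingType) m (F : nat -> nat -> R) :
  ndet m F = ndet m (fun i j => F j i).
Proof. by rewrite /ndet -det_tr; congr (\det _); apply/matrixP=> i j; rewrite !mxE. Qed.

(** Block Gaussian elimination of [B] and [C] against the invertible block [D]. *)
Lemma det_schur_complement (R : comUnitRingType) (p q : nat) (A : 'M[R]_p)
    (B : 'M_(p, q)) (C : 'M_(q, p)) (D Di : 'M_q) :
  Di *m D = 1%:M ->
  \det (block_mx A B C D) = \det D * \det (A - B *m Di *m C).
Proof.
move=> DiD.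
have -> : block_mx A B C D =
    block_mx (A - B *m Di *m C) B 0 D *m block_mx 1%:M 0 (Di *m C) 1%:M.
  have DDi : D *m Di = 1%:M by apply: mulmx1C.
  rewrite mulmx_block !mulmx1 !mulmx0 !add0r (mulmxA D) DDi mul1mx.
  by rewrite mulmxA subrK.
by rewrite det_mulmx det_ublock det_lblock !det1 !mulr1 mulrC.
Qed.

(** Exchanging the two block columns makes the matrix block triangular. *)
Lemma det_block_anti (R : comNzRingType) (q : nat) (P Q E : 'M[R]_q) :
  \det (block_mx P Q E 0) = (-1) ^+ q * \det Q * \det E.
Proof.
have : \det (block_mx P Q E 0 *m block_mx 0 1%:M 1%:M 0) = \det Q * \det E.
  by rewrite mulmx_block !mulmx0 !mulmx1 !add0r !addr0 det_ublock.
rewrite det_mulmx.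
suff -> : \det (block_mx 0 1%:M 1%:M 0 : 'M[R]_(q + q)) = (-1) ^+ q.
  by move=> H; rewrite -mulrA -H mulrCA -expr2 sqrr_sign mulr1.
(* The exchange of two vectors as a product of transvections and one sign. *)
have -> : block_mx 0 1%:M 1%:M 0 =
   block_mx 1%:M 0 1%:M (1%:M : 'M[R]_q) *m block_mx 1%:M 1%:M 0 (- 1%:M)
     *m block_mx 1%:M 0 (- 1%:M) 1%:M.
  rewrite !mulmx_block !(mulmx0, mulmx1, mul0mx, mul1mx, mulmxN).
  by rewrite !(add0r, addr0, opprK, subrr, oppr0).
by rewrite !det_mulmx !det_lblock det_ublock -scaleN1r detZ !det1 !mulr1 !mul1r.
Qed.

(** Cramer's rule for the row vector h times the inverse of H, the row that
    replaces row [j] being kept on top; moving it back costs the sign. *)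
Lemma det_swap_row (R : comNzRingType) (q : nat) (h : nat -> R)
    (H : nat -> nat -> R) (j : 'I_q) :
  ndet q (fun i k => if i is i'.+1 then H (bump j i') k else h k) =
  (-1) ^+ j * (\sum_(k < q) h k * \adj (\matrix_(i < q, k < q) H i k) k j).
Proof.
case: q j => [|q] j; first by case: j.
rewrite /ndet (expand_det_row _ ord0) mulr_sumr; apply: eq_bigr=> k _.
rewrite !mxE /= /cofactor add0n.
set d := \det (row' j _).
have -> : (-1) ^+ j * (h k * ((-1) ^+ (j + k) * d)) = h k * ((-1) ^+ k * d).
  rewrite mulrCA exprD; congr (_ * _).
  by rewrite !mulrA -expr2 sqrr_sign mul1r.
by rewrite /d; congr (_ * (_ * \det _)); apply/matrixP=> i l; rewrite !mxE.
Qed.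

(** * Bordering a block determinant with a zero corner *)

Definition ncons (x : nat) (f : nat -> nat) (i : nat) : nat :=
  if i is i'.+1 then f i' else x.

Section Bordered.
Variables (R : comUnitRingType) (q : nat) (S H E : nat -> nat -> R).

(** The shape of the Lascoux-Pragacz determinant; [H] and [E] already contain
    the Frobenius coordinates of the inner partition. *)
Definition lpdet (N : nat) (a b : nat -> nat) : R :=
  (-1) ^+ q * \det (block_mx
    (\matrix_(i < N, j < N) S (a i) (b j)) (\matrix_(i < N, j < q) H (a i) j)
    (\matrix_(i < q, j < N) E i (b j)) (0 : 'M_q)).

Variables (g d : nat -> nat).
Let H0 : 'M_q := \matrix_(i, j) H (g i) j.
Let E0 : 'M_q := \matrix_(i, j) E i (d j).
Let S0 : 'M_q := \matrix_(i, j) S (g i) (d j).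
Hypotheses (detH : \det H0 = 1) (detE : \det E0 = 1).

(** The first row and column border an invertible block matrix with blocks S0,
    H0, E0, 0, so the determinant is a 1 x 1 Schur complement. *)
Lemma lpdet_corner (x y : nat) :
  lpdet q.+1 (ncons x g) (ncons y d) =
  (S x y)
  - ((\row_j H x j) *m \adj H0 *m (\col_i S (g i) y)) 0 0
  - ((\row_j S x (d j)) *m \adj E0 *m (\col_i E i y)) 0 0
  + ((\row_j H x j) *m \adj H0 *m S0 *m \adj E0 *m (\col_i E i y)) 0 0.
Proof.
rewrite /lpdet.
pose z := fun _ _ : nat => 0 : R.
have -> : (0 : 'M[R]_q) = \matrix_(i, j) z i j by apply/matrixP=> i j; rewrite !mxE.
rewrite -(ndet_block _ _ (fun i j => S (ncons x g i) (ncons y d j))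
  (fun i j => H (ncons x g i) j) (fun i j => E i (ncons y d j)) z).
pose B := nblock 1 q (fun _ j => S x (d j)) (fun _ j => H x j) z z.
pose C := nblock q 1 (fun i _ => S (g i) y) z (fun i _ => E i y) z.
pose D := nblock q q (fun i j => S (g i) (d j)) (fun i j => H (g i) j)
  (fun i j => E i (d j)) z.
rewrite (@eq_ndet _ _ _ (nblock 1 1 (fun _ _ => S x y) B C D)); last first.
  move=> [|i] [|j] _ _; rewrite /B /C /D /nblock /= ?subn1 ?ltnS //=; by case: ltnP.
rewrite (_ : q.+1 + q = 1 + (q + q))%N // ndet_block.
have eB : \matrix_(i < 1, j < q + q) B i j =
   row_mx (\row_j S x (d j)) (\row_j H x j).
  apply/matrixP=> i j; rewrite !mxE /B /nblock ord1 /=.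
  by case: splitP => k kE; rewrite !mxE kE ?addKn.
have eC : \matrix_(i < q + q, j < 1) C i j =
   col_mx (\col_i S (g i) y) (\col_i E i y).
  apply/matrixP=> i j; rewrite !mxE /C /nblock ord1 /=.
  by case: splitP => k kE; rewrite !mxE kE ?addKn.
have eD : \matrix_(i < q + q, j < q + q) D i j = block_mx S0 H0 E0 0.
  rewrite /D nblock_mx; congr (block_mx _ _ _ _).
  by apply/matrixP=> i j; rewrite !mxE.
have HH : \adj H0 *m H0 = 1%:M by rewrite mul_adj_mx detH.
have EE : \adj E0 *m E0 = 1%:M by rewrite mul_adj_mx detE.
(* As H0 and E0 have determinant 1, their adjugates are their inverses, and
   the matrix on the left inverts the core. *)
have KK : block_mx 0 (\adj E0) (\adj H0) (- (\adj H0 *m S0 *m \adj E0))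
    *m block_mx S0 H0 E0 0 = 1%:M.
  rewrite mulmx_block !mul0mx !mulmx0 !addr0 !add0r EE HH mulNmx.
  by rewrite -!mulmxA EE mulmx1 subrr -scalar_mx_block.
rewrite eB eC eD (det_schur_complement _ _ _ KK) det_block_anti detH detE !mulr1.
rewrite mulrA -expr2 sqrr_sign mul1r det_mx11.
rewrite mul_row_block mul_row_col mulmx0 add0r mulmxN mulmxDl mulNmx !mulmxA.
by rewrite !mxE !opprD opprK !addrA.
Qed.

(** All four blocks are square, so the determinant factors, and the block of
    complete functions is [H0] with row [j] removed and a new row on top. *)
Lemma lpdet_row (x : nat) (j : 'I_q) :
  lpdet q (ncons x (fun k => g (bump j k))) d =
  (-1) ^+ j * \sum_(k < q) H x k * \adj H0 k j.
Proof.
rewrite /lpdet det_block_anti detE mulr1 mulrA -expr2 sqrr_sign mul1r.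
rewrite -(det_swap_row _ (fun i k => H (g i) k)).
by congr (\det _); apply/matrixP=> -[[|i] ?] l; rewrite !mxE.
Qed.

Lemma lpdet_col (y : nat) (i : 'I_q) :
  lpdet q g (ncons y (fun k => d (bump i k))) =
  (-1) ^+ i * \sum_(k < q) \adj E0 i k * E k y.
Proof.
rewrite /lpdet det_block_anti detH mulr1 mulrA -expr2 sqrr_sign mul1r.
have -> : \adj E0 = (\adj (\matrix_(k < q, l < q) E l (d k)))^T.
  by rewrite trmx_adj; congr (\adj _); apply/matrixP=> k l; rewrite !mxE.
transitivity ((-1) ^+ i * \sum_(k < q) E k y *
   \adj (\matrix_(k < q, l < q) E l (d k)) k i); last first.
  by congr (_ * _); apply: eq_bigr=> k _; rewrite [_^T _ _]mxE mulrC.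
rewrite -/(ndet q (fun k l => E k (ncons y (fun l => d (bump i l)) l))) ndet_tr.
apply: etrans (det_swap_row (fun k => E k y) (fun i k => E k (d i)) i).
by rewrite /ndet; congr (\det _); apply/matrixP=> -[[|k] ?] l; rewrite !mxE.
Qed.

Theorem bordered_lpdet (p : nat) (a b : nat -> nat) :
  lpdet p a b = (-1) ^+ q * \det (block_mx
    (\matrix_(i < p, j < p) lpdet q.+1 (ncons (a i) g) (ncons (b j) d))
    (\matrix_(i < p, j < q) lpdet q (ncons (a i) (fun k => g (bump j k))) d)
    (\matrix_(i < q, j < p) lpdet q g (ncons (b j) (fun k => d (bump i k))))
    (0 : 'M_q)).
Proof.
congr (_ * _).
pose Sab := \matrix_(i < p, j < p) S (a i) (b j).
pose Sad := \matrix_(i < p, j < q) S (a i) (d j).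
pose Sgb := \matrix_(i < q, j < p) S (g i) (b j).
pose Ha := \matrix_(i < p, j < q) H (a i) j.
pose Eb := \matrix_(i < q, j < p) E i (b j).
pose J := diag_mx (\row_(j < q) (-1) ^+ j) : 'M[R]_q.
have eA : \matrix_(i < p, j < p) lpdet q.+1 (ncons (a i) g) (ncons (b j) d) =
    Sab - Ha *m \adj H0 *m Sgb - Sad *m \adj E0 *m Eb
    + Ha *m \adj H0 *m S0 *m \adj E0 *m Eb.
  have rowE (n : nat) (f : nat -> nat -> R) (M : 'M_(p, n)) (i : 'I_p) :
     M = \matrix_(i, j) f (a i) j -> \row_j f (a i) j = row i M.
    by move=> ->; apply/rowP=> j; rewrite !mxE.
  have colE' (n : nat) (f : nat -> nat -> R) (M : 'M_(n, p)) (j : 'I_p) :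
     M = \matrix_(i, j) f i (b j) -> \col_i f i (b j) = col j M.
    by move=> ->; apply/colP=> i; rewrite !mxE.
  apply/matrixP=> i j; rewrite mxE lpdet_corner.
  rewrite (rowE _ H Ha) // (rowE _ (fun x j => S x (d j)) Sad) //.
  rewrite (colE' _ E Eb) // (colE' _ (fun i y => S (g i) y) Sgb) //.
  have cmul n (M : 'M[R]_(p, n)) (K : 'M[R]_(n, p)) : M *m col j K = col j (M *m K).
    by rewrite !colE mulmxA.
  have rcE (M : 'M[R]_p) : row i (col j M) 0 0 = M i j by rewrite 2!mxE.
  rewrite -!row_mul !cmul !rcE [RHS]mxE; congr (_ + _).
  rewrite [RHS]mxE; congr (_ + _); last by rewrite [RHS]mxE.
  by rewrite [RHS]mxE; congr (_ + _); rewrite [RHS]mxE.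
have eB : \matrix_(i < p, j < q) lpdet q (ncons (a i) (fun k => g (bump j k))) d =
    Ha *m (\adj H0 *m J).
  apply/matrixP=> i j; rewrite mxE lpdet_row mulmxA mul_mx_diag !mxE mulrC.
  by congr (_ * _); apply: eq_bigr=> k _; rewrite !mxE.
have eC : \matrix_(i < q, j < p) lpdet q g (ncons (b j) (fun k => d (bump i k))) =
    J *m \adj E0 *m Eb.
  apply/matrixP=> i j; rewrite mxE lpdet_col -mulmxA mul_diag_mx !mxE.
  by congr (_ * _); apply: eq_bigr=> k _; rewrite !mxE.
rewrite eA eB eC.
(* The correction terms of the upper left block have the form [Ha *m X] or
   [Y *m Eb], so column operations with [Ha] and row operations with [Eb]
   produce them. *)
have -> : block_mx (Sab - Ha *m \adj H0 *m Sgb - Sad *m \adj E0 *m Eb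
    + Ha *m \adj H0 *m S0 *m \adj E0 *m Eb) (Ha *m (\adj H0 *m J))
    (J *m \adj E0 *m Eb) 0 =
  block_mx 1%:M (Ha *m \adj H0 *m S0 *m \adj E0 - Sad *m \adj E0) 0 (J *m \adj E0)
  *m block_mx Sab Ha Eb 0
  *m block_mx 1%:M 0 (- (\adj H0 *m Sgb)) (\adj H0 *m J).
  rewrite !mulmx_block !(mul1mx, mulmx1, mulmx0, mul0mx, oppr0, addr0, add0r, mulmxN, mulmxBl).
  rewrite !mulmxA; congr (block_mx _ _ _ _).
  set a1 := Ha *m _ *m S0 *m _ *m Eb; set b1 := Sad *m _ *m Eb.
  set c1 := Ha *m _ *m Sgb.
  by rewrite (addrC a1) (addrA Sab) (addrAC _ a1 (- c1)) (addrAC Sab (- b1)).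
have dH : \det (\adj H0) = 1.
  by rewrite -[LHS]mulr1 -detH -det_mulmx mul_adj_mx detH det1.
have dE : \det (\adj E0) = 1.
  by rewrite -[LHS]mulr1 -detE -det_mulmx mul_adj_mx detE det1.
rewrite !det_mulmx det_ublock det_lblock !det_mulmx !det1 dH dE !mul1r !mulr1.
rewrite mulrAC -expr2.
(* The signs of the Cramer coordinates occur once in B and once in C. *)
suff -> : \det J ^+ 2 = 1 by rewrite mul1r.
rewrite det_diag -prodrXl big1 // => i _.
by rewrite mxE sqrr_sign.
Qed.
End Bordered.

(** * Complete and elementary symmetric polynomials *)

Definition zext (R : nmodType) (f : nat -> R) (z : int) : R :=
  if z is Posz k then f k else 0.

Lemma zext_subn (R : nmodType) (f : nat -> R) (s t : nat) :
  zext f (s%:Z - t%:Z) = if (t <= s)%N then f (s - t)%N else 0.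
Proof.
case: leqP => st; first by rewrite subzn.
by rewrite -opprB subzn ?(ltnW st) //; case: (t - s)%N (subn_gt0 s t) => [|k];
  rewrite ?st.
Qed.

Section CompleteElementary.
Variables (R : comNzRingType) (x : nat -> R).

(** The complete polynomial of degree [k] in the first [m] variables, the
    exponent of the last variable being k - i. *)
Fixpoint hpoly (m k : nat) : R :=
  if m is m'.+1 then \sum_(i < k.+1) hpoly m' i * x m' ^+ (k - i)
  else (k == 0)%:R.

Fixpoint epoly (m k : nat) : R :=
  if m is m'.+1 then
    epoly m' k + (if k is k'.+1 then epoly m' k' * x m' else 0)
  else (k == 0)%:R.

Lemma hpoly0 m : hpoly m 0 = 1.
Proof. by elim: m => //= m IH; rewrite big_ord1 IH mul1r. Qed.

Lemma epoly0 m : epoly m 0 = 1.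
Proof. by elim: m => //= m ->; rewrite addr0. Qed.

Lemma hpolyS m k : hpoly m.+1 k.+1 = hpoly m k.+1 + x m * hpoly m.+1 k.
Proof.
rewrite /= big_ord_recr /= subnn mulr1 addrC mulr_sumr; congr (_ + _).
apply: eq_bigr=> i _; rewrite subSn -1?ltnS // exprS.
by rewrite mulrCA.
Qed.

(** Passing to one more variable multiplies one generating function by
    1 - x t and the other by its inverse. *)
Lemma epoly_hpoly m k :
  \sum_(i < k.+1) (-1) ^+ i * epoly m i * hpoly m (k - i) = (k == 0)%:R.
Proof.
elim: m k => [|m IH] k.
  rewrite big_ord_recl /= mul1r subn0 big1 ?addr0 ?mul1r // => i _.
  by rewrite mulr0 mul0r.
rewrite -[RHS]IH.
case: k => [|k]; first by rewrite !big_ord1 subn0 !hpoly0 !epoly0.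
rewrite [RHS]big_ord_recr subnn hpoly0 mulr1.
have -> : \sum_(i < k.+2) (-1) ^+ i * epoly m.+1 i * hpoly m.+1 (k.+1 - i) =
    \sum_(i < k.+2) (-1) ^+ i * epoly m i * hpoly m.+1 (k.+1 - i) +
    \sum_(i < k.+2) (-1) ^+ i * (if nat_of_ord i is i'.+1 then epoly m i' * x m else 0)
       * hpoly m.+1 (k.+1 - i).
  by rewrite -big_split; apply: eq_bigr=> i _; rewrite /= mulrDr mulrDl.
have sub_max : (k.+1 - @ord_max k.+1 = 0)%N by rewrite /= subnn.
rewrite [X in X + _]big_ord_recr sub_max hpoly0 mulr1 addrAC; congr (_ + _).
rewrite [X in _ + X]big_ord_recl mulr0 mul0r add0r -big_split.
apply: eq_bigr=> i _; have ik : (i <= k)%N by rewrite -ltnS.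
rewrite lift0 subSS (subSn ik) hpolyS exprS. 
change ((-1) ^+ i * epoly m i * (hpoly m (k - i).+1 + x m * hpoly m.+1 (k - i))
  + (-1 * (-1) ^+ i * (epoly m i * x m) * hpoly m.+1 (k - i)) =
  (-1) ^+ i * epoly m i * hpoly m (k - i).+1).
by ring.
Qed.

(** The alternating sum for the hook Schur function (a|b) that results from
    expanding its Jacobi-Trudi determinant. *)
Definition hookS (m a b : nat) : R :=
  \sum_(r < b.+1) (-1) ^+ r * epoly m (b - r) * hpoly m (a + r).+1.

End CompleteElementary.

Lemma zext_ge (R : nmodType) (f : nat -> R) (s t : nat) :
  (t <= s)%N -> zext f (s%:Z - t%:Z) = f (s - t)%N.
Proof. by rewrite zext_subn => ->. Qed.

Lemma zext_lt (R : nmodType) (f : nat -> R) (s t : nat) :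
  (s < t)%N -> zext f (s%:Z - t%:Z) = 0.
Proof. by move=> st; rewrite zext_subn leqNgt st. Qed.

(** * Toeplitz sums and complements of sequences *)

Lemma sum_zextr (R : comNzRingType) (F g : nat -> R) (N c : nat) : (c < N)%N ->
  \sum_(u < N) F u * zext g (c%:Z - u%:Z) = \sum_(u < c.+1) F u * g (c - u)%N.
Proof.
move=> cN; rewrite -(big_mkord xpredT (fun u => F u * zext g (c%:Z - u%:Z))).
rewrite (big_cat_nat (n := c.+1)) //= [X in _ + X]big_nat [X in _ + X]big1 => [|u /andP[cu _]].
  by rewrite addr0 big_mkord; apply: eq_bigr=> u _; rewrite zext_ge // -ltnS.
by rewrite zext_lt // mulr0.
Qed.

Lemma sum_zext2 (R : comNzRingType) (f g : nat -> R) (N r c : nat) : (c < N)%N ->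
  \sum_(u < N) zext f (u%:Z - r%:Z) * zext g (c%:Z - u%:Z) =
  if (r <= c)%N then \sum_(i < (c - r).+1) f i * g (c - r - i)%N else 0.
Proof.
move=> cN; rewrite (sum_zextr (fun u => zext f (u%:Z - r%:Z)) g cN); case: leqP => rc; last first.
  by rewrite big1 // => u _; rewrite zext_lt ?mul0r // (leq_trans (ltn_ord u)).
rewrite -(big_mkord xpredT (fun u => zext f (u%:Z - r%:Z) * g (c - u)%N)).
rewrite (big_cat_nat (n := r)) ?leqW //= [X in X + _]big_nat [X in X + _]big1 => [|u /andP[_ ur]].
  rewrite add0r -{1}[r]add0n big_addn subSn // big_mkord.
  by apply: eq_bigr=> i _; rewrite zext_ge ?leq_addl // addnK addnC subnDA.
by rewrite zext_lt ?mul0r.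
Qed.

Lemma det_uptrig (R : comNzRingType) (q : nat) (M : 'M[R]_q) :
  (forall i j : 'I_q, (j < i)%N -> M i j = 0) -> (forall i, M i i = 1) -> \det M = 1.
Proof.
move=> M0 M1; rewrite -det_tr det_trig; first by rewrite big1 // => i _; rewrite mxE.
by apply/is_trig_mxP=> i j ij; rewrite mxE M0.
Qed.

(** If c 0 > c 1 > ... > c (p - 1), the increasing enumeration of the naturals
    that are not values of [c]: the gaps are opened from the smallest upwards. *)
Fixpoint skips (p : nat) (c : nat -> nat) (i : nat) : nat :=
  if p is p'.+1 then bump (c 0%N) (skips p' (fun k => c k.+1) i) else i.

Definition sdecr (p : nat) (c : nat -> nat) : Prop :=
  forall i j, (i < j)%N -> (j < p)%N -> (c j < c i)%N.

Lemma sdecrS p c : sdecr p.+1 c -> sdecr p (fun k => c k.+1).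
Proof. by move=> dc i j ij jp; apply: dc. Qed.

Lemma skips_addl p base c k :
  skips p (fun j => base + c j)%N (base + k) = (base + skips p c k)%N.
Proof. by elim: p c => //= p IH c; rewrite IH bumpDl. Qed.

Lemma skips_small p c i : (forall j, (j < p)%N -> (i < c j)%N) -> skips p c i = i.
Proof.
elim: p c => //= p IH c ic; rewrite IH => [|j jp]; last exact: ic.
by rewrite /bump leqNgt ic.
Qed.

(** The set with [m] elements that remains has only one increasing enumeration;
    removing the largest gap b 0 gives the induction. *)
Lemma skips_unique p m (b f : nat -> nat) :
  sdecr p b -> (forall j, (j < p)%N -> (b j < p + m)%N) ->
  (forall i, (i < m)%N -> (f i < p + m)%N) ->
  (forall i j, (i < j)%N -> (j < m)%N -> (f i < f j)%N) ->
  (forall i j, (i < m)%N -> (j < p)%N -> f i <> b j) ->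
  forall i, (i < m)%N -> f i = skips p b i.
Proof.
elim: p b f => [|p IH] b f decb bN fN incf avoid i im /=.
  have ge k : (k < m)%N -> (k <= f k)%N.
    elim: k => // k IHk km.
    by apply: leq_trans (incf k k.+1 (leqnn _) km); rewrite ltnS IHk // ltnW.
  have le k : (k < m)%N -> (f (m.-1 - k)%N <= m.-1 - k)%N.
    elim: k => [|k IHk] km.
      by rewrite subn0; have := fN m.-1; clear -km; lia.
    have := incf (m.-1 - k.+1)%N (m.-1 - k)%N; have := IHk (ltnW km); lia.
  by have := ge _ im; have := le (m.-1 - i)%N; rewrite subKn; lia.
pose f' i := unbump (b 0%N) (f i).
have b0f k : (k < m)%N -> f k != b 0%N by move=> km; apply/eqP/avoid.
have f'K k : (k < m)%N -> f k = bump (b 0%N) (f' k).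
  by move=> km; rewrite /f' unbumpK // inE b0f.
rewrite f'K // -(IH (fun k => b k.+1) f') //.
- exact: sdecrS.
- by move=> j jp; have := bN 0%N isT; have := decb 0%N j.+1 isT jp; lia.
- move=> k km; have := fN k km; have := bN 0%N isT; have := b0f k km.
  by rewrite /f' /unbump; lia.
- move=> k l kl lm; have := incf k l kl lm; have := b0f l lm.
  by have := b0f k (ltn_trans kl lm); rewrite /f' /unbump; lia.
- move=> k j km jp; have := decb 0%N j.+1 isT jp; have := avoid k j.+1 km jp.
  by have := b0f k km; rewrite /f' /unbump; lia.
Qed.

(** Successive Laplace expansion along [p] unit columns. Since the rows are
    deleted from the largest index down, the later positions do not shift, and
    the sign is read off directly. *)
Lemma ndet_unit_cols (R : comNzRingType) (p m o : nat) (c : nat -> nat)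
    (F : nat -> nat -> R) :
  (o <= m)%N -> sdecr p c -> (forall j, (j < p)%N -> (c j < p + m)%N) ->
  (forall i j, (i < p + m)%N -> (j < p)%N -> F i (o + j)%N = (i == c j)%:R) ->
  ndet (p + m) F = (-1) ^+ (\sum_(j < p) (o + c j)) *
     ndet m (fun i j => F (skips p c i) (if (j < o)%N then j else (p + j)%N)).
Proof.
move=> om; elim: p c F => [|p IH] c F decc cN Fu.
  rewrite big_ord0 mul1r; apply: eq_ndet => i j _ _ /=; by case: ifP.
rewrite addSn (@ndet_unit_col _ _ (c 0%N) o).
- rewrite (IH (fun k => c k.+1)).
  + rewrite mulrA -exprD [in RHS]big_ord_recl [(o + _)%N]addnC; congr (_ * _).
    apply: eq_ndet => i j _ _ /=; congr (F _ _).
    by rewrite /bump; case: ltnP; case: leqP; lia.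
  + exact: sdecrS.
  + by move=> j jp; have := decc 0%N j.+1 isT jp; have := cN 0%N isT; lia.
  + move=> i j ip jp; have dj := decc 0%N j.+1 isT jp.
    rewrite (_ : bump o (o + j) = o + j.+1)%N ?Fu //; last 1 first.
    * by rewrite /bump leq_addr addnS.
    * by congr (_ %:R); congr nat_of_bool; apply/eqP/eqP; rewrite /bump; lia.
    * by rewrite /bump; lia.
- exact: cN.
- by lia.
- by move=> i ip; rewrite -(addn0 o) Fu.
Qed.

Lemma ndet_unit_rows (R : comNzRingType) (p m o : nat) (c : nat -> nat)
    (F : nat -> nat -> R) :
  (o <= m)%N -> sdecr p c -> (forall j, (j < p)%N -> (c j < p + m)%N) ->
  (forall i j, (i < p)%N -> (j < p + m)%N -> F (o + i)%N j = (j == c i)%:R) ->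
  ndet (p + m) F = (-1) ^+ (\sum_(j < p) (o + c j)) *
     ndet m (fun i j => F (if (i < o)%N then i else (p + i)%N) (skips p c j)).
Proof.
move=> om dc cN Fu; rewrite ndet_tr (@ndet_unit_cols _ p m o c) //.
- by rewrite [in RHS]ndet_tr.
- by move=> i j ip jp; rewrite Fu.
Qed.

(** * From the Jacobi-Trudi to the Lascoux-Pragacz determinant *)

Lemma signr_subn (R : pzRingType) (k l : nat) :
  (l <= k)%N -> (-1) ^+ (k - l) = (-1) ^+ k * (-1) ^+ l :> R.
Proof. by move=> lk; rewrite -[in RHS](subnK lk) exprD -mulrA -expr2 sqrr_sign mulr1. Qed.

Section JacobiTrudiToFrobenius.
Variables (R : comUnitRingType) (x : nat -> R) (n : nat).
Let h := hpoly x n.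
Let e := epoly x n.
Let f k := (-1) ^+ k * e k.

Lemma toeplitz_inv (N : nat) :
  (\matrix_(i < N, j < N) zext f (j%:Z - i%:Z)) *m
  (\matrix_(i < N, j < N) zext h (j%:Z - i%:Z)) = 1%:M.
Proof.
apply/matrixP=> r c; rewrite !mxE.
under eq_bigr do rewrite !mxE.
rewrite sum_zext2 // -(inj_eq val_inj) /=.
case: leqP => [rc|]; last by case: ltngtP.
by rewrite epoly_hpoly subn_eq0 eqn_leq rc.
Qed.

Variables (N p q : nat) (al be ga de : nat -> nat).
Hypotheses (pN : (p <= N)%N) (qN : (q <= N)%N).
Hypotheses (decb : sdecr p be) (beN : forall j, (j < p)%N -> (be j < N)%N).
Hypotheses (decd : sdecr q de) (deN : forall j, (j < q)%N -> (de j < N)%N).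

(* The border: rows [al], then unit rows at [de]; columns that are unit at
   [be], then columns [ga]. An index t of the Toeplitz block stands for the
   Jacobi-Trudi index -1 - t. *)
Let A i j := if (i < p)%N && (p <= j)%N then zext h ((al i)%:Z - (ga (j - p)%N)%:Z)
             else 0.
Let B i c := if (i < p)%N then h (al i + c).+1 else (c == de (i - p)%N)%:R.
Let C r j := if (j < p)%N then (r == be j)%:R else 0 : R.
Let T r c := zext h (c%:Z - r%:Z).
Let Z := nblock (p + q) (p + q) A B C T.

Let hs := hookS x n.
Let H a j := zext h (a%:Z - (ga j)%:Z).
Let E i b := zext e (b%:Z - (de i)%:Z).

(** Eliminating the Toeplitz block. The unit borders select entries of its
    inverse, which give [E]; against the rows [al] they give the alternating sums
    [hookS]. *)
Lemma border_schur :
  ndet (p + q + N) Z =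
  (-1) ^+ (p + \sum_(j < p) be j + \sum_(j < q) de j) *
   \det (block_mx
    (\matrix_(i < p, j < p) hs (al i) (be j)) (\matrix_(i < p, j < q) H (al i) j)
    (\matrix_(i < q, j < p) E i (be j)) (0 : 'M_q)).
Proof.
rewrite /Z ndet_block (det_schur_complement _ _ _ (toeplitz_inv N)).
rewrite [X in X * _]det_uptrig => [|i j ij|i]; last 2 first.
- by rewrite mxE /T zext_lt.
- by rewrite mxE /T zext_ge // subnn /h hpoly0.
rewrite mul1r.
pose Dl := diag_mx (\row_(j < p) - (-1) ^+ be j) : 'M[R]_p.
pose Dr := diag_mx (\row_(j < q) (-1) ^+ de j) : 'M[R]_q.
set L := (_ - _); set M := block_mx _ _ _ _.
have -> : L = block_mx 1%:M 0 0 Dr *m M *m block_mx Dl 0 0 1%:M.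
  have BT (i : 'I_(p + q)) (j : 'I_N) :
     (\matrix_(i < p + q, j < N) B i j *m
       \matrix_(i < N, j < N) zext f (j%:Z - i%:Z)) i j =
     \sum_(u < N) B i u * zext f (j%:Z - u%:Z).
    by rewrite mxE; apply: eq_bigr=> u _; rewrite !mxE.
  have BTC (i : 'I_(p + q)) (j : 'I_(p + q)) :
     (\matrix_(i < p + q, j < N) B i j *m
       \matrix_(i < N, j < N) zext f (j%:Z - i%:Z) *m
       \matrix_(i < N, j < p + q) C i j) i j =
     if (j < p)%N then \sum_(u < N) B i u * zext f ((be j)%:Z - u%:Z) else 0.
    rewrite mxE; case: ifP => jp; last first.
      by rewrite big1 // => u _; rewrite [X in _ * X]mxE /C jp mulr0.
    rewrite (bigD1 (Ordinal (beN jp))) //= BT [X in _ * X]mxE /C jp eqxx mulr1.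
    rewrite [X in _ + X]big1 ?addr0 // => u ub; rewrite [X in _ * X]mxE jp.
    by rewrite -(inj_eq val_inj) in ub; rewrite (negPf ub) mulr0.
  have LE i j : L i j = A i j -
      (if (j < p)%N then \sum_(u < N) B i u * zext f ((be j)%:Z - u%:Z) else 0).
    by rewrite /L [LHS]mxE [X in X + _]mxE [X in _ + X]mxE BTC.
  clearbody L.
  rewrite !mulmx_block !(mul1mx, mulmx1, mulmx0, mul0mx, addr0, add0r).
  rewrite -[L]submxK; congr block_mx; apply/matrixP=> i j.
  - rewrite mul_mx_diag !mxE LE /A /= ltn_ord leqNgt ltn_ord /= add0r.
    have -> : \sum_(u < N) B i u * zext f ((be j)%:Z - u%:Z) =
        (-1) ^+ be j * hs (al i) (be j).
      rewrite (sum_zextr _ _ (beN (ltn_ord j))) mulr_sumr.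
      apply: eq_bigr=> u _; rewrite /B ltn_ord /f mulrCA.
      have ub : (u <= be j)%N by rewrite -ltnS.
      by rewrite (signr_subn _ ub) -/h -/e; ring.
    by ring.
  - rewrite !mxE LE /A /= ltn_ord leq_addr /= ltnNge leq_addr /= oppr0 addr0.
    by rewrite addKn.
  - rewrite mul_mx_diag mul_diag_mx !mxE LE /A /= ltnNge leq_addr /= add0r ltn_ord.
    rewrite (bigD1 (Ordinal (deN (ltn_ord i)))) //= big1 => [|u ud].
      rewrite /B ltnNge leq_addr /= addKn eqxx mul1r addr0 /E.
      rewrite !zext_subn; case: leqP => db; last by rewrite !(mulr0, mul0r, oppr0).
      by rewrite /f (signr_subn _ db); ring.
    rewrite /B ltnNge leq_addr /= addKn.
    by rewrite -(inj_eq val_inj) in ud; rewrite (negPf ud) mul0r.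
  - by rewrite !mxE LE /A /= ltnNge leq_addr /= ltnNge leq_addr /= subrr.
rewrite !det_mulmx !det_lblock !det1 mul1r mulr1 mulrAC; congr (_ * _).
rewrite !det_diag.
under eq_bigr do rewrite mxE.
under [X in _ * X]eq_bigr do rewrite mxE -mulN1r.
rewrite big_split /= !prodrXr prodr_const card_ord !exprD.
by rewrite mulrC.
Qed.

(** Expanding along the unit borders: what remains is a minor of the Toeplitz
    matrix extended by the rows [al] and the columns [ga]. *)
Lemma border_minor :
  ndet (p + q + N) Z =
  (-1) ^+ (p + q + \sum_(j < p) be j + \sum_(j < q) de j) *
  ndet N (nblock p q (fun i j => zext h ((al i)%:Z - (ga j)%:Z))
                     (fun i j => h (al i + skips q de j).+1)
                     (fun _ _ => 0)
                     (fun i j => zext h ((skips q de j)%:Z - (skips p be i)%:Z))).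
Proof.
have dec' s k c : sdecr k c -> sdecr k (fun j => s + c j)%N.
  by move=> dc i j ij jk; rewrite ltn_add2l dc.
rewrite -addnA (@ndet_unit_cols _ p (q + N) 0 (fun j => p + q + be j)%N) //; first last.
- move=> i j ip jp; rewrite add0n /Z /nblock /A /C.
  rewrite (leq_trans jp (leq_addr _ _)) jp (leqNgt p) jp andbF.
  case: ltnP => ipq.
    by have -> : (i == p + q + be j)%N = false by lia.
  by congr (_ %:R); congr nat_of_bool; apply/eqP/eqP; lia.
- by move=> j jp; rewrite addnA ltn_add2l beN.
- exact: dec'.
rewrite (@ndet_unit_rows _ q N p (fun j => q + de j)%N) //; first last.
- move=> i j iq jN /=.
  rewrite skips_small => [|k kp]; last by lia.
  rewrite /Z /nblock /A /B ltn_add2l iq ltn_add2l (ltnNge _ p) leq_addr /= addKn.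
  case: ltnP => jq.
    by have -> : (j == q + de i)%N = false by lia.
  by congr (_ %:R); congr nat_of_bool; apply/eqP/eqP; lia.
- by move=> j jq; rewrite ltn_add2l deN.
- exact: dec'.
rewrite mulrA -exprD; congr (_ * _).
  under eq_bigr do rewrite add0n.
  under [X in (_ + X)%N]eq_bigr do rewrite addnA.
  rewrite !big_split /= !sum_nat_const !card_ord.
  set b := \sum_(j < p) _; set d := \sum_(j < q) _.
  (* The offsets of the border contribute (p + q)^2 to the exponent. *)
  have -> : (p * p + p * q + b + (q * p + q * q + d) = (p + q) * (p + q) + (b + d))%N.
    by rewrite mulnDl !mulnDr addnACA.
  rewrite -addnA [LHS]exprD [RHS]exprD; congr (_ * _).
  by rewrite -signr_odd oddM andbb signr_odd.
apply: eq_ndet => i j iN jN /=.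
have -> : skips p (fun j : nat => p + q + be j)%N (if (i < p)%N then i else (q + i)%N) =
   if (i < p)%N then i else (p + q + skips p be (i - p))%N.
  case: ltnP => ip; first by apply: skips_small => k _; lia.
  by rewrite -skips_addl; congr skips; lia.
have -> : skips q (fun j : nat => q + de j)%N j =
   if (j < q)%N then j else (q + skips q de (j - q))%N.
  case: ltnP => jq; first by apply: skips_small => k _; lia.
  by rewrite -skips_addl; congr skips; lia.
rewrite /Z /nblock /A /B /C /T.
case: (ltnP i p) => ip; case: (ltnP j q) => jq.
- by rewrite (ltn_addr q ip) ip ltn_add2l jq leq_addr addKn.
- by rewrite (ltn_addr q ip) ip addnA ltnNge leq_addr addKn.
- by rewrite ltnNge leq_addr /= ltn_add2l jq ltnNge leq_addr.
- by rewrite ltnNge leq_addr /= addnA ltnNge leq_addr /= !addKn.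
Qed.

Theorem ndet_nblock_lpdet :
  ndet N (nblock p q (fun i j => zext h ((al i)%:Z - (ga j)%:Z))
                     (fun i j => h (al i + skips q de j).+1)
                     (fun _ _ => 0)
                     (fun i j => zext h ((skips q de j)%:Z - (skips p be i)%:Z))) =
  lpdet q hs H E p al be.
Proof.
rewrite /lpdet; set d1 := ndet _ _; set d2 := \det _.
have := border_minor; rewrite border_schur -/d1 -/d2 => eqd.
have {}eqd : (-1) ^+ (p + \sum_(j < p) be j + \sum_(j < q) de j) * ((-1) ^+ q * d1) =
   (-1) ^+ (p + \sum_(j < p) be j + \sum_(j < q) de j) * d2.
  by rewrite eqd mulrA -exprD; congr (_ ^+ _ * _); lia.
have {}eqd : (-1) ^+ q * d1 = d2.
  by rewrite -[RHS](signrMK (p + \sum_(j < p) be j + \sum_(j < q) de j)) -eqd signrMK.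
by rewrite -eqd signrMK.
Qed.

End JacobiTrudiToFrobenius.

(** * Frobenius coordinates *)

Lemma part_nonincr (la : seq nat) : is_partition la ->
  forall i j, (i <= j)%N -> (nth 0 la j <= nth 0 la i)%N.
Proof.
move=> /andP[sla _] i j ij; case: (ltnP j (size la)) => js; last by rewrite nth_default.
have gtr : transitive geq by move=> a b c /= ab bc; apply: leq_trans bc ab.
by apply: (sorted_leq_nth gtr (@leqnn) 0 sla) => //; rewrite inE // (leq_ltn_trans ij).
Qed.

Lemma count_initial (P : pred nat) (m k : nat) :
  (forall i j, (i <= j)%N -> P j -> P i) -> (k < m)%N ->
  (k < count P (iota 0 m))%N = P k.
Proof.
move=> Pd km; case Pk: (P k).
  rewrite -(subnKC km) iotaD count_cat.
  have -> : count P (iota 0 k.+1) = k.+1.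
    rewrite -[RHS](size_iota 0); apply/eqP; rewrite -all_count.
    by apply/allP=> i; rewrite mem_iota => /andP[_ ik]; apply: Pd Pk.
  by rewrite leq_addr.
rewrite -(subnKC (ltnW km)) iotaD count_cat [X in (_ + X)%N](_ : _ = 0%N).
  by rewrite addn0 ltnNge -[X in (_ <= X)%N](size_iota 0 k) count_size.
apply/eqP; rewrite -leqn0 leqNgt -has_count; apply/hasPn=> i.
rewrite mem_iota add0n => /andP[ki _]; apply/negP=> /(Pd _ _ ki).
by rewrite Pk.
Qed.

Lemma durfeeP (la : seq nat) : is_partition la ->
  forall i, (i < durfee la)%N = (i < nth 0 la i)%N.
Proof.
move=> hla i; case: (ltnP i (size la)) => il.
  rewrite /durfee count_initial // => j k jk kl.
  exact: leq_ltn_trans jk (leq_trans kl (part_nonincr hla jk)).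
rewrite [in RHS]nth_default // ltn0; apply/negbTE; rewrite -leqNgt.
by apply: leq_trans (count_size _ _) _; rewrite size_iota.
Qed.

Lemma durfee_size (la : seq nat) : (durfee la <= size la)%N.
Proof. by apply: leq_trans (count_size _ _) _; rewrite size_iota. Qed.

Lemma conj_partP (la : seq nat) : is_partition la ->
  forall i j, (i < conj_part la j)%N = (j < nth 0 la i)%N.
Proof.
move=> hla i j.
have -> : conj_part la j = count (fun i => j < nth 0 la i)%N (iota 0 (size la)).
  by rewrite -(count_map (nth 0%N la)) map_nth_iota0 // take_size.
case: (ltnP i (size la)) => il.
  rewrite count_initial // => k l kl jl.
  exact: leq_trans jl (part_nonincr hla kl).
rewrite [in RHS]nth_default // ltn0; apply/negbTE; rewrite -leqNgt.
by apply: leq_trans (count_size _ _) _; rewrite size_iota.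
Qed.

Section Frobenius.
Variables (la : seq nat) (hla : is_partition la).
Let p := durfee la.

Lemma nth_frob_arms i : (i < p)%N ->
  (nth 0 la i = nth 0 (frob_arms la) i + i.+1)%N.
Proof.
by move=> ip; rewrite nth_mkseq // subnK // -durfeeP.
Qed.

Lemma nth_frob_legs j : (j < p)%N ->
  (conj_part la j = nth 0 (frob_legs la) j + j.+1)%N.
Proof.
by move=> jp; rewrite nth_mkseq // subnK // conj_partP // -durfeeP.
Qed.

Lemma conj_part_nonincr i j : (i <= j)%N -> (conj_part la j <= conj_part la i)%N.
Proof.
move=> ij; apply: sub_count => r /= jr; exact: leq_ltn_trans jr.
Qed.

Lemma frob_arms_decr : sdecr p (nth 0%N (frob_arms la)).
Proof.
move=> i j ij jp; have := nth_frob_arms jp.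
by have := nth_frob_arms (ltn_trans ij jp); have := part_nonincr hla (ltnW ij); lia.
Qed.

Lemma frob_legs_decr : sdecr p (nth 0%N (frob_legs la)).
Proof.
move=> i j ij jp; have := nth_frob_legs jp.
by have := nth_frob_legs (ltn_trans ij jp); have := conj_part_nonincr (ltnW ij); lia.
Qed.

Variable N : nat.
Hypothesis laN : (size la <= N)%N.

Lemma frob_legs_lt j : (j < p)%N -> (nth 0 (frob_legs la) j < N)%N.
Proof.
move=> jp; have := nth_frob_legs jp.
by have : (conj_part la j <= size la)%N := count_size _ _; move: laN; lia.
Qed.

(** On the boundary path of the diagram, vertical and horizontal steps are
    complementary. Below the Durfee square this makes the numbers i - la_i (rows
    counted from 0) the complement of the legs, in increasing order. *)
Lemma skips_frob_legs i : (p <= i)%N -> (i < N)%N ->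
  (skips p (nth 0 (frob_legs la)) (i - p) + nth 0 la i = i)%N.
Proof.
move=> pi iN.
have lei k : (p <= k)%N -> (nth 0 la k <= k)%N.
  by move=> pk; rewrite leqNgt -durfeeP // -leqNgt.
rewrite -(@skips_unique p (N - p) _ (fun k => p + k - nth 0 la (p + k))%N).
- by rewrite subnKC // subnK // lei.
- exact: frob_legs_decr.
- by move=> j jp; rewrite subnKC ?frob_legs_lt // (leq_trans (durfee_size la)).
- by move=> k kN; lia.
- move=> k l kl lN; have := lei (p + k)%N (leq_addr _ _).
  have := part_nonincr hla (_ : p + k <= p + l)%N; rewrite leq_add2l (ltnW kl) => /(_ isT).
  by lia.
(* A common value would contradict i < la'_j iff j < la_i at i = p + k. *)
- move=> k j kN jp; have := nth_frob_legs jp; have := lei (p + k)%N (leq_addr _ _).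
  have := conj_partP hla (p + k)%N j.
  by case: ltnP; case: ltnP; lia.
- by lia.
Qed.

End Frobenius.

Definition jtdet (R : comNzRingType) (x : nat -> R) (n N : nat) (la mu : nat -> nat) : R :=
  ndet N (fun i j => zext (hpoly x n) ((la i + j)%:Z - (mu j + i)%:Z)).

Lemma jtdet_lpdet (R : comUnitRingType) (x : nat -> R) (n N : nat) (la mu : seq nat) :
  is_partition la -> is_partition mu -> (size la <= N)%N -> (size mu <= N)%N ->
  jtdet x n N (nth 0%N la) (nth 0%N mu) =
  lpdet (durfee mu) (hookS x n)
    (fun a j => zext (hpoly x n) (a%:Z - (nth 0%N (frob_arms mu) j)%:Z))
    (fun i b => zext (epoly x n) (b%:Z - (nth 0%N (frob_legs mu) i)%:Z))
    (durfee la) (nth 0%N (frob_arms la)) (nth 0%N (frob_legs la)).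
Proof.
move=> hla hmu laN muN.
rewrite -(@ndet_nblock_lpdet _ x n N); first last.
- exact: frob_legs_lt.
- exact: frob_legs_decr.
- exact: frob_legs_lt.
- exact: frob_legs_decr.
- exact: leq_trans (durfee_size _) muN.
- exact: leq_trans (durfee_size _) laN.
apply: eq_ndet => i j iN jN; rewrite /nblock.
case: (ltnP i (durfee la)) => ip; case: (ltnP j (durfee mu)) => jq.
- have := nth_frob_arms hla ip; have := nth_frob_arms hmu jq => e1 e2.
  by congr (zext _ _); lia.
- have := nth_frob_arms hla ip; have := skips_frob_legs hmu muN jq jN => e1 e2.
  by rewrite zext_ge; [congr (hpoly _ _ _); lia | lia].
- have := skips_frob_legs hla laN ip iN; have := nth_frob_arms hmu jq => e1 e2.
  by rewrite zext_lt //; lia.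
- have := skips_frob_legs hla laN ip iN; have := skips_frob_legs hmu muN jq jN => e1 e2.
  by congr (zext _ _); lia.
Qed.

(** * Branching of the Jacobi-Trudi determinant *)

Lemma ndet_row0 (R : comNzRingType) (m r : nat) (F : nat -> nat -> R) :
  (r < m)%N -> (forall j, (j < m)%N -> F r j = 0) -> ndet m F = 0.
Proof.
move=> rm F0; rewrite /ndet (expand_det_row _ (Ordinal rm)) big1 // => j _.
by rewrite mxE F0 ?mul0r.
Qed.

Definition nonincr (la : nat -> nat) := forall i j, (i <= j)%N -> (la j <= la i)%N.

(** With no variables only h_0 survives. At the first place where the two
    partitions differ, the matrix has a zero row or a zero column. *)
Lemma jtdet0 (R : comNzRingType) (x : nat -> R) (N : nat) (la mu : nat -> nat) :
  nonincr la -> nonincr mu ->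
  jtdet x 0 N la mu = [forall i : 'I_N, la i == mu i]%:R.
Proof.
move=> hla hmu.
have E i j : zext (hpoly x 0) ((la i + j)%:Z - (mu j + i)%:Z) = (la i + j == mu j + i)%:R.
  rewrite zext_subn /=; case: leqP => h; first by congr (_ %:R); lia.
  by case: eqP => //; lia.
case: (boolP [forall i, _]) => [/forallP eqlm | /forallPn /= nelm].
  rewrite /jtdet /ndet det_uptrig // => [i j ij|i]; rewrite mxE E.
    by have := hla _ _ (ltnW ij); have := eqP (eqlm j); case: eqP => //; lia.
  by rewrite (eqP (eqlm i)) eqxx.
have {nelm} [i0 iN [ne min]] : exists2 i0, (i0 < N)%N &
    la i0 != mu i0 /\ forall i, (i < i0)%N -> la i = mu i.
  have ex : exists i, (i < N)%N && (la i != mu i).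
    by case: nelm => i ne; exists i; rewrite ltn_ord.
  case: (ex_minnP ex) => i0 /andP[iN ne] min; exists i0 => //; split=> // i ii.
  apply/eqP; case: eqP => // /eqP nei; have := min i.
  by rewrite nei (ltn_trans ii iN) => /(_ isT); rewrite leqNgt ii.
case: (ltngtP (la i0) (mu i0)) ne => // lt _.
  rewrite /jtdet ndet_tr (@ndet_row0 _ _ i0) // => j jN; rewrite E.
  case: (ltnP j i0) => ji.
    by have := hmu _ _ (ltnW ji); have := min _ ji; case: eqP => //; lia.
  by have := hla _ _ ji; case: eqP => //; lia.
rewrite /jtdet (@ndet_row0 _ _ i0) // => j jN; rewrite E.
case: (ltnP j i0) => ji.
  by have := hla _ _ (ltnW ji); have := min _ ji; case: eqP => //; lia.
by have := hmu _ _ ji; case: eqP => //; lia.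
Qed.

(** Multilinearity in the rows, expanded over all choices of a summand in
    each row. *)
Lemma det_sum_rows (R : comNzRingType) (N : nat) (V : finType)
    (P : 'I_N -> pred V) (G : 'I_N -> V -> 'I_N -> R) :
  \det (\matrix_(i, j) \sum_(v | P i v) G i v j) =
  \sum_(f : {ffun 'I_N -> V} | [forall i, P i (f i)]) \det (\matrix_(i, j) G i (f i) j).
Proof.
rewrite /determinant.
under eq_bigr => s _.
  under eq_bigr do rewrite mxE.
  rewrite bigA_distr_big_dep mulr_sumr; over.
rewrite exchange_big /=; apply: eq_big => [f|f _].
  by apply/familyP/forallP.
apply: eq_bigr=> s _; congr (_ * _); by apply: eq_bigr=> i _; rewrite mxE.
Qed.

Lemma det_scale_rows (R : comNzRingType) (N : nat) (d : 'I_N -> R) (M : 'I_N -> 'I_N -> R) :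
  \det (\matrix_(i, j) (d i * M i j)) = (\prod_i d i) * \det (\matrix_(i, j) M i j).
Proof.
have -> : \matrix_(i, j) (d i * M i j) = diag_mx (\row_i d i) *m \matrix_(i, j) M i j.
  by apply/matrixP=> i j; rewrite mul_diag_mx !mxE.
by rewrite det_mulmx det_diag; congr (_ * _); apply: eq_bigr=> i _; rewrite mxE.
Qed.

Lemma sum_ord_between (R : nmodType) (c a b : nat) (F : nat -> R) :
  (a <= b)%N -> (b <= c)%N ->
  \sum_(v < c.+1 | (a <= v <= b)%N) F (b - v)%N = \sum_(k < (b - a).+1) F k.
Proof.
move=> ab bc; rewrite -(big_mkord xpredT F) big_nat_rev /=.
rewrite -(big_mkord (fun v => a <= v <= b)%N (fun v => F (b - v)%N)).
transitivity (\sum_(a <= v < b.+1) F (b - v)%N); last first.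
  rewrite -{1}[a]add0n big_addn subSn // big_nat [RHS]big_nat.
  by apply: eq_bigr=> i ik; congr F; lia.
by rewrite (big_nat_widenl a 0) // (big_nat_widen _ b.+1 c.+1) ?ltnS //.
Qed.

(** The parts [nu], continued by zeros. *)
Definition shape (N c : nat) (nu : {ffun 'I_N -> 'I_c.+1}) (i : nat) : nat :=
  if insub i is Some o then nu o else 0%N.

Lemma shapeE N c (nu : {ffun 'I_N -> 'I_c.+1}) (i : 'I_N) : shape nu i = nu i.
Proof. by rewrite /shape valK. Qed.

Lemma shape_ge N c (nu : {ffun 'I_N -> 'I_c.+1}) i : (N <= i)%N -> shape nu i = 0%N.
Proof. by move=> Ni; rewrite /shape insubF // ltnNge Ni. Qed.

Definition interlace (N c : nat) (la : nat -> nat) (nu : {ffun 'I_N -> 'I_c.+1}) : bool :=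
  [forall i : 'I_N, (la i.+1 <= nu i <= la i)%N].

Lemma zext_hpolyS (R : comNzRingType) (x : nat -> R) (n : nat) (z : int) :
  zext (hpoly x n.+1) z = zext (hpoly x n) z + x n * zext (hpoly x n.+1) (z - 1).
Proof.
case: z => [[|k]|k].
- rewrite (_ : 0%N%:Z - 1 = Negz 0) // [zext _ (Negz 0)]/= mulr0 addr0.
  by rewrite [LHS]/zext [RHS]/zext !hpoly0.
- by rewrite (_ : k.+1%:Z - 1 = k%:Z); [exact: hpolyS | lia].
- rewrite (_ : Negz k - 1 = Negz k.+1); last by rewrite !NegzE; lia.
  by rewrite /= mulr0 addr0.
Qed.

Lemma zext_hpoly_iter (R : comNzRingType) (x : nat -> R) (n d : nat) (z : int) :
  zext (hpoly x n.+1) z =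
  \sum_(k < d) x n ^+ k * zext (hpoly x n) (z - k%:Z) +
  x n ^+ d * zext (hpoly x n.+1) (z - d%:Z).
Proof.
elim: d => [|d IH]; first by rewrite big_ord0 add0r mul1r subr0.
rewrite IH big_ord_recr /= -addrA; congr (_ + _).
rewrite zext_hpolyS mulrDr mulrA -exprSr; congr (_ + _ * zext _ _).
by lia.
Qed.

(** Subtracting from each row the multiple of the next one by x^(la_i - la_(i+1)
    + 1) truncates h_k(x, x') = sum_v x^v h_(k-v)(x') so that exactly the
    parts between la_(i+1) and la_i remain; multilinearity then gives the sum over
    interlacing nu, without cancellation. *)
Lemma jtdetS (R : comNzRingType) (x : nat -> R) (n N c : nat) (la mu : nat -> nat) :
  nonincr la -> (la 0 <= c)%N -> la N = 0%N ->
  jtdet x n.+1 N la mu =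
  \sum_(nu : {ffun 'I_N -> 'I_c.+1} | interlace la nu)
    (\prod_(i < N) x n ^+ (la i - nu i)) * jtdet x n N (shape nu) mu.
Proof.
move=> hla lac laN.
pose U := \matrix_(i < N, j < N)
  ((i == j)%:R - (j == i.+1 :> nat)%:R * x n ^+ (la i - la i.+1).+1) : 'M[R]_N.
have dU : \det U = 1.
  apply: det_uptrig => [i j ij|i]; rewrite mxE.
    rewrite -(inj_eq val_inj) /= gtn_eqF // (_ : (j == i.+1 :> nat) = false).
      by rewrite mul0r subr0.
    by lia.
  by rewrite eqxx ltn_eqF // mul0r subr0.
rewrite /jtdet /ndet -[LHS]mul1r -[X in X * _ = _]dU -det_mulmx.
set M := _ *m _.
pose G (i : 'I_N) (v : 'I_c.+1) (j : 'I_N) : R :=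
  x n ^+ (la i - v) * zext (hpoly x n) ((v + j)%:Z - (mu j + i)%:Z).
have -> : M = \matrix_(i, j) \sum_(v : 'I_c.+1 | (la i.+1 <= v <= la i)%N) G i v j.
  apply/matrixP=> i j; rewrite !mxE.
  have lei : (la i.+1 <= la i)%N by apply: hla.
  have lic : (la i <= c)%N by apply: leq_trans lac; apply: hla.
  rewrite (eq_bigr (fun v : 'I_c.+1 => (fun k => x n ^+ k *
     zext (hpoly x n) ((la i + j)%:Z - (mu j + i)%:Z - k%:Z)) (la i - v)%N)); last first.
    by move=> v /andP[_ vl]; rewrite /G; congr (_ * zext _ _); lia.
  rewrite (sum_ord_between (fun k => x n ^+ k *
     zext (hpoly x n) ((la i + j)%:Z - (mu j + i)%:Z - k%:Z)) lei lic).
  under eq_bigr do rewrite !mxE mulrBl.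
  rewrite sumrB (bigD1 i) //= eqxx mul1r [X in _ + X - _]big1 => [|k ki]; last first.
    by rewrite eq_sym (negPf ki) mul0r.
  rewrite addr0 (zext_hpoly_iter _ _ (la i - la i.+1).+1) -[RHS]addr0 -addrA.
  congr (_ + _); apply/eqP; rewrite subr_eq0; apply/eqP.
  case: (ltnP i.+1 N) => iN.
    rewrite (bigD1 (Ordinal iN)) //= eqxx mul1r big1 => [|k ki]; last first.
      by rewrite -(inj_eq val_inj) in ki; rewrite (negPf ki) !mul0r.
    by rewrite addr0; congr (_ * zext _ _); lia.
  (* No row follows the last one, and the term to be cancelled has a negative
     index. *)
  have eN : i.+1 = N by apply/eqP; rewrite eqn_leq iN ltn_ord.
  rewrite big1 => [|k _]; last first.
    by rewrite (_ : (k == i.+1 :> nat) = false) ?mul0r //; have := ltn_ord k; lia.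
  have laS : la i.+1 = 0%N by rewrite eN.
  rewrite (_ : (la i + j)%:Z - (mu j + i)%:Z - (la i - la i.+1).+1%:Z =
    j%:Z - (mu j + i.+1)%:Z); last by lia.
  by rewrite zext_lt ?mulr0 //; have := ltn_ord j; lia.
rewrite det_sum_rows; apply: eq_bigr=> nu _.
rewrite det_scale_rows /jtdet /ndet; congr (_ * \det _).
by apply/matrixP=> i j; rewrite !mxE shapeE.
Qed.

(** * Branching of tableaux *)

Lemma card_initial (c : nat) (P : pred 'I_c) :
  (forall i j : 'I_c, (i <= j)%N -> P j -> P i) ->
  forall j : 'I_c, (j < #|P|)%N = P j.
Proof.
move=> Pd j.
pose P' (i : nat) := if insub i is Some o then P o else false.
have P'E (i : 'I_c) : P' i = P i by rewrite /P' valK.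
have -> : #|P| = count P' (iota 0 c).
  rewrite -val_enum_ord count_map cardE enumT size_filter.
  by apply: eq_count => i /=; rewrite P'E.
rewrite -P'E; apply: count_initial => // i k ik Pk.
have kc : (k < c)%N.
  by rewrite ltnNge; apply: contraTN Pk => ck; rewrite /P' insubF // ltnNge ck.
have ic := leq_ltn_trans ik kc.
have := P'E (Ordinal ic); have := P'E (Ordinal kc) => /= ek ei.
by move: Pk; rewrite ei ek; apply: Pd.
Qed.

Section GridTableaux.
(* Tableaux live on a fixed grid with [N] rows and [c] columns and use a fixed
   alphabet; only the shapes and the number [k] of allowed letters vary, so that
   splitting off a letter does not change any type. *)
Variables (R : comNzRingType) (x : nat -> R) (n N c : nat).

Definition cell (la mu : nat -> nat) (u : 'I_N * 'I_c) : bool :=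
  (mu u.1 <= u.2 < la u.1)%N.

(** The letter with index i is stored as i + 1; entry 0 marks the places outside
    the skew diagram, which then have weight 1. *)
Definition tab (k : nat) (la mu : nat -> nat) (T : {ffun 'I_N * 'I_c -> 'I_n.+1}) : bool :=
  [&& [forall u, cell la mu u == (0 < T u)%N], [forall u, (T u <= k)%N] &
   [forall u, forall v, cell la mu u && cell la mu v ==>
     (((u.1 == v.1) && (u.2 < v.2)%N ==> (T u <= T v)%N) &&
      ((u.2 == v.2) && (u.1 < v.1)%N ==> (T u < T v)%N))]].

Definition weight (T : {ffun 'I_N * 'I_c -> 'I_n.+1}) : R :=
  \prod_u (if val (T u) is j.+1 then x j else 1).

Definition gschur (k : nat) (la mu : nat -> nat) : R :=
  if [forall i : 'I_N, (mu i <= la i)%N]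
  then \sum_(T | tab k la mu T) weight T else 0.

Lemma tabP k la mu (T : {ffun 'I_N * 'I_c -> 'I_n.+1}) :
  reflect [/\ forall u, cell la mu u = (0 < T u)%N, forall u, (T u <= k)%N,
    forall (i : 'I_N) (j1 j2 : 'I_c), cell la mu (i, j1) -> cell la mu (i, j2) ->
      (j1 < j2)%N -> (T (i, j1) <= T (i, j2))%N &
    forall (i1 i2 : 'I_N) (j : 'I_c), cell la mu (i1, j) -> cell la mu (i2, j) ->
      (i1 < i2)%N -> (T (i1, j) < T (i2, j))%N]
  (tab k la mu T).
Proof.
apply: (iffP and3P) => [[/forallP h1 /forallP h2 /forallP h3] | [h1 h2 h3 h4]].
  split=> [u | u | i j1 j2 c1 c2 lt | i1 i2 j c1 c2 lt].
  - exact/eqP/h1.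
  - exact: h2.
  - by have /forallP/(_ (i, j2)) := h3 (i, j1); rewrite c1 c2 /= eqxx lt => /andP[].
  - by have /forallP/(_ (i2, j)) := h3 (i1, j); rewrite c1 c2 /= eqxx lt => /andP[].
split; apply/forallP=> u; [by rewrite h1 | exact: h2 |].
apply/forallP=> v; apply/implyP=> /andP[cu cv].
case: u v cu cv => [i j] [i' j'] /= cu cv; apply/andP; split; apply/implyP=> /= /andP[/eqP e lt].
  by move: cv; rewrite -e => cv; apply: h3 cu cv lt.
by move: cv; rewrite -e => cv; apply: h4 cu cv lt.
Qed.

Variables (la mu : nat -> nat).
Hypotheses (hla : nonincr la) (hmu : nonincr mu).
Hypotheses (lac : (la 0 <= c)%N) (laN : forall i, (N <= i)%N -> la i = 0%N).

Let lac' i : (la i <= c)%N.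
Proof. by apply: leq_trans lac; apply: hla. Qed.

(** The outer shape of the letters at most [k], counted row by row. *)
Definition inner (k : nat) (T : {ffun 'I_N * 'I_c -> 'I_n.+1}) : {ffun 'I_N -> 'I_c.+1} :=
  [ffun i : 'I_N => inord #|[pred j : 'I_c | (j < mu i)%N || (0 < T (i, j) <= k)%N]|].

(** Rows increase weakly, so the counted places form an initial segment. *)
Lemma innerP k T (i : 'I_N) (j : 'I_c) : tab k.+1 la mu T ->
  (j < inner k T i)%N = (j < mu i)%N || (0 < T (i, j) <= k)%N.
Proof.
case/tabP=> h1 h2 h3 h4; rewrite ffunE inordK; last first.
  by rewrite ltnS; apply: leq_trans (max_card _) _; rewrite card_ord.
rewrite card_initial // => j1 j2 j12 /= /orP[jmu | /andP[T0 Tk]].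
  by rewrite (leq_ltn_trans j12 jmu).
case: (ltnP j1 (mu i)) => //= mj.
have c2 : cell la mu (i, j2) by rewrite h1.
have c1 : cell la mu (i, j1).
  by move: c2; rewrite /cell /= mj => /andP[_]; apply: leq_ltn_trans.
rewrite -(h1 (i, j1)) c1 /=; case: (ltngtP j1 j2) j12 => // [lt _ | e _].
  exact: leq_trans (h3 _ _ _ c1 c2 lt) Tk.
by rewrite (ord_inj e).
Qed.

(** Columns increase strictly, so the largest letter occurs at most once in each
    column: it fills a horizontal strip. *)
Lemma inner_interlace k T : (forall i : 'I_N, (mu i <= la i)%N) -> tab k.+1 la mu T ->
  interlace la (inner k T) && [forall i : 'I_N, (mu i <= inner k T i)%N].
Proof.
move=> hml tT; have innP i j := innerP i j tT; case/tabP: tT => h1 h2 h3 h4.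
have nuc (i : 'I_N) : (inner k T i <= c)%N by rewrite -ltnS.
have mun (i : 'I_N) : (mu i <= inner k T i)%N.
  rewrite leqNgt; apply/negP => lt.
  have jc : (inner k T i < c)%N by apply: leq_trans (leq_trans lt _) (lac' i).
  by have := innP i (Ordinal jc); rewrite ltnn /= lt.
apply/andP; split; apply/forallP=> i //; apply/andP; split; rewrite leqNgt; apply/negP => lt.
  have iN : (i.+1 < N)%N by rewrite ltnNge; apply/negP => /laN l0; rewrite l0 in lt.
  have jc : (inner k T i < c)%N by apply: leq_trans lt _.
  have := innP i (Ordinal jc); rewrite ltnn /= => /esym/negbT.
  rewrite negb_or -leqNgt => /andP[muj].
  have c1 : cell la mu (i, Ordinal jc).
    by rewrite /cell /= muj; apply: leq_trans lt (hla (leqnSn i)).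
  have c2 : cell la mu (Ordinal iN, Ordinal jc).
    by rewrite /cell /= lt andbT; apply: leq_trans (hmu (leqnSn i)) muj.
  rewrite -(h1 (i, _)) c1 /= -ltnNge => kT.
  have := h4 _ _ _ c1 c2 (ltnSn i); have := h2 (Ordinal iN, Ordinal jc).
  by lia.
have jc : (la i < c)%N by apply: leq_trans lt _.
have := innP i (Ordinal jc); rewrite /= lt => /esym/orP[|/andP[T0 _]].
  by rewrite ltnNge hml.
by move: T0; rewrite -h1 /cell /= ltnn andbF.
Qed.

Section Strip.
Variables (k : nat) (kn : (k < n)%N) (nu : {ffun 'I_N -> 'I_c.+1}).
Hypotheses (hnu : interlace la nu) (munu : [forall i : 'I_N, (mu i <= nu i)%N]).

Definition strip (u : 'I_N * 'I_c) : bool := (nu u.1 <= u.2 < la u.1)%N.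

Definition fill (T : {ffun 'I_N * 'I_c -> 'I_n.+1}) : {ffun 'I_N * 'I_c -> 'I_n.+1} :=
  [ffun u => if strip u then inord k.+1 else T u].
Definition unfill (T : {ffun 'I_N * 'I_c -> 'I_n.+1}) : {ffun 'I_N * 'I_c -> 'I_n.+1} :=
  [ffun u => if T u == k.+1 :> nat then ord0 else T u].

Let nula (i : 'I_N) : (nu i <= la i)%N. Proof. by case/andP: (forallP hnu i). Qed.
Let lanu (i : 'I_N) : (la i.+1 <= nu i)%N. Proof. by case/andP: (forallP hnu i). Qed.
Let mnu (i : 'I_N) : (mu i <= nu i)%N. Proof. exact: (forallP munu i). Qed.

Lemma unfillK T : tab k.+1 la mu T -> inner k T = nu -> fill (unfill T) = T.
Proof.
move=> tT eT; have innP i j := innerP i j tT; case/tabP: tT => h1 h2 h3 h4.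
apply/ffunP=> -[i j]; rewrite !ffunE /strip /=.
have := innP i j; have := h1 (i, j); have := h2 (i, j); rewrite eT /cell /=.
have := mnu i; have := nula i.
case: (boolP (nu i <= j < la i)%N) => [s|s]; last by case: eqP => // e; lia.
by move=> *; apply: val_inj; rewrite /= inordK ?ltnS //; lia.
Qed.

(** [fill] and [unfill] are inverse bijections between tableaux of shape nu/mu
    with letters up to [k] and tableaux of shape la/mu with letters up to k + 1
    whose largest letters fill the strip la/nu. *)
Lemma tab_fill T :
  (tab k.+1 la mu (fill T) && (inner k (fill T) == nu)) && (unfill (fill T) == T) =
  tab k (shape nu) mu T.
Proof.
have cellE u : cell (shape nu) mu u = (mu u.1 <= u.2 < nu u.1)%N.
  by rewrite /cell shapeE.
have k1 : (inord k.+1 : 'I_n.+1) = k.+1 :> nat by rewrite inordK.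
apply/idP/idP.
  case/andP=> /andP[tT /eqP eT] /eqP uT.
  have innP (i : 'I_N) (j : 'I_c) :
      (j < nu i)%N = (j < mu i)%N || (0 < fill T (i, j) <= k)%N.
    by rewrite -(innerP _ _ tT) eT.
  case/tabP: tT => h1 h2 h3 h4.
  have TE u : T u = if fill T u == k.+1 :> nat then ord0 else fill T u.
    by rewrite -{1}uT ffunE.
  have cellT u : cell (shape nu) mu u -> T u = fill T u /\ cell la mu u.
    rewrite cellE => /andP[m1 m2]; case: u m1 m2 => i j /= m1 m2.
    have := innP i j; rewrite m2 ltnNge m1 /= => /esym/andP[T0 Tk].
    by split; [rewrite TE ltn_eqF | rewrite h1].
  apply/tabP; split=> [u|u|i j1 j2 /cellT[-> c1] /cellT[-> c2]|i1 i2 j /cellT[-> c1] /cellT[-> c2]].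
  - apply/idP/idP => [cu|]; first by have [-> cl] := cellT _ cu; rewrite -h1.
    rewrite TE; case: ifP => // /eqP ne T0.
    have := h2 u; have := h1 u; rewrite T0 /cell => /andP[m1 m2] Tk.
    rewrite shapeE m1; case: u ne T0 m1 m2 Tk => i j /= ne T0 m1 m2 Tk.
    by rewrite innP T0; apply/orP; right; lia.
  - by rewrite TE; case: ifP => // /eqP ne; have := h2 u; lia.
  - exact: h3.
  - exact: h4.
case/tabP=> h1 h2 h3 h4.
have T1 u : strip u -> fill T u = k.+1 :> nat by move=> su; rewrite ffunE su.
have T2 u : ~~ strip u -> fill T u = T u by move=> su; rewrite ffunE (negPf su).
have Ts u : strip u -> T u = ord0.
  move=> /andP[su _]; apply: val_inj => /=; apply/eqP.
  by rewrite -leqn0 leqNgt -h1 cellE (ltnNge _ (nu _)) su andbF.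
have tT : tab k.+1 la mu (fill T).
  apply/tabP; split=> [u|u|i j1 j2 c1 c2 lt|i1 i2 j c1 c2 lt].
  - case: (boolP (strip u)) => su; first rewrite (T1 _ su) /cell.
      by case/andP: su => s1 ->; rewrite (leq_trans (mnu _) s1).
    rewrite (T2 _ su) -h1 cellE /cell; case: (mu _ <= _)%N => //=.
    move: su; rewrite /strip negb_and -ltnNge -leqNgt; have := nula u.1; lia.
  - case: (boolP (strip u)) => su; first by rewrite (T1 _ su).
    by rewrite (T2 _ su) ltnW // ltnS.
  - case: (boolP (strip (i, j2))) => s2.
      rewrite (T1 _ s2); case: (boolP (strip (i, j1))) => s1; first by rewrite (T1 _ s1).
      by rewrite (T2 _ s1) ltnW // ltnS.
    have m2 : (j2 < nu i)%N.
      by move: s2 c2; rewrite /strip /cell /= => s2 /andP[_ c2]; rewrite c2 andbT -ltnNge in s2.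
    have s1 : ~~ strip (i, j1) by rewrite /strip /= leqNgt (ltn_trans lt m2).
    rewrite (T2 _ s1) (T2 _ s2); apply: h3 => //; rewrite cellE /= ?m2 ?(ltn_trans lt m2) andbT.
      by case/andP: c1.
    by case/andP: c2.
  - (* A place of the strip above another cell of la would violate
       la_(i1+1) <= nu_(i1). *)
    have m1 : (j < nu i1)%N.
      have := lanu i1; have := hla lt; case/andP: c2 => /= _; lia.
    have s1 : ~~ strip (i1, j) by rewrite /strip /= leqNgt m1.
    rewrite (T2 _ s1); case: (boolP (strip (i2, j))) => s2.
      by rewrite (T1 _ s2) ltnS.
    rewrite (T2 _ s2); apply: h4 => //; rewrite cellE /=.
      by rewrite m1 andbT; case/andP: c1.
    by move: s2 c2; rewrite /strip /cell /= => s2 /andP[-> c2]; rewrite c2 andbT -ltnNge in s2.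
rewrite tT /=; apply/andP; split; apply/eqP/ffunP.
  move=> i; apply: ord_inj; have inn j := innerP i j tT.
  have innE (j : 'I_c) : (j < inner k (fill T) i)%N = (j < nu i)%N.
    rewrite inn; case: (ltnP j (mu i)) => jm /=; first by rewrite (leq_trans jm).
    case: (boolP (strip (i, j))) => s.
      by rewrite (T1 _ s) ltnn andbF ltnNge; case/andP: s => /= ->.
    by rewrite (T2 _ s) h2 andbT -h1 cellE /= jm.
  have [b1 b2] : (inner k (fill T) i <= c)%N /\ (nu i <= c)%N by split; rewrite -ltnS.
  case: (ltngtP (inner k (fill T) i) (nu i)) => // lt.
    by have := innE (Ordinal (leq_trans lt b2)); rewrite /= ltnn lt.
  by have := innE (Ordinal (leq_trans lt b1)); rewrite /= ltnn lt.
move=> u; rewrite ffunE; case: (boolP (strip u)) => su.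
  by rewrite (T1 _ su) eqxx (Ts _ su).
by rewrite (T2 _ su) ltn_eqF // ltnS.
Qed.

Lemma weight_fill T : tab k (shape nu) mu T ->
  weight (fill T) = (\prod_(i < N) x k ^+ (la i - nu i)) * weight T.
Proof.
case/tabP=> h1 _ _ _.
have -> : \prod_(i < N) x k ^+ (la i - nu i) = \prod_u (if strip u then x k else 1).
  rewrite -(pair_bigA _ (fun i j => if strip (i, j) then x k else 1)) /=.
  apply: eq_bigr=> i _; rewrite -big_mkcond /strip /=.
  rewrite -(big_mkord (fun j => nu i <= j < la i)%N (fun _ => x k)).
  rewrite -prodr_const_nat (big_nat_widenl _ 0) // (big_nat_widen _ (la i) c) //.
rewrite -big_split; apply: eq_bigr=> u _; rewrite ffunE; case: ifP => su /=; last by rewrite mul1r.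
rewrite inordK // (_ : T u = ord0) ?mulr1 //; apply: val_inj => /=; apply/eqP.
rewrite -leqn0 leqNgt -h1 /cell shapeE.
by case/andP: su => s1 _; rewrite (ltnNge _ (nu _)) s1 andbF.
Qed.

End Strip.

Lemma gschurS k : (k < n)%N ->
  gschur k.+1 la mu = \sum_(nu : {ffun 'I_N -> 'I_c.+1} | interlace la nu)
    (\prod_(i < N) x k ^+ (la i - nu i)) * gschur k (shape nu) mu.
Proof.
move=> kn; rewrite /gschur.
have shE (nu : {ffun 'I_N -> 'I_c.+1}) :
  [forall i : 'I_N, (mu i <= shape nu i)%N] = [forall i : 'I_N, (mu i <= nu i)%N].
  by apply: eq_forallb => i; rewrite shapeE.
case: ifP => ml; last first.
  rewrite big1 // => nu hnu; rewrite shE; case: ifP; rewrite ?mulr0 // => mn.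
  case/negP: ml; apply/forallP=> i; apply: leq_trans (forallP mn i) _.
  by case/andP: (forallP hnu i).
rewrite (bigID (fun nu : {ffun 'I_N -> 'I_c.+1} => [forall i : 'I_N, (mu i <= nu i)%N])) /=.
rewrite [X in _ + X]big1 ?addr0 => [|nu /andP[_ mn]]; last first.
  by rewrite shE (negPf mn) mulr0.
rewrite (partition_big (inner k)
  (fun nu => interlace la nu && [forall i : 'I_N, (mu i <= nu i)%N])) /=; last first.
  by move=> T; apply: inner_interlace; apply/forallP.
apply: eq_bigr=> nu /andP[hnu mn]; rewrite shE mn.
rewrite (reindex_onto (fill k nu) (unfill k)) /=; last first.
  by move=> T /andP[tT /eqP eT]; apply: unfillK.
rewrite mulr_sumr; apply: eq_big => [T | T]; first by rewrite tab_fill.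
by rewrite tab_fill //; apply: weight_fill.
Qed.

Lemma gschur0 : gschur 0 la mu = [forall i : 'I_N, la i == mu i]%:R.
Proof.
rewrite /gschur; case: ifP => ml; last first.
  case: forallP => // e; case/negP: ml; apply/forallP=> i.
  by rewrite (eqP (e i)).
case: forallP => e.
  rewrite (bigD1 [ffun=> ord0]) /=; last first.
    apply/tabP; split=> [[i j]|u|i j1 j2|i1 i2 j]; rewrite ?ffunE // /cell /=.
      by rewrite (eqP (e i)); case: leqP.
    by rewrite (eqP (e i1)); case: leqP.
  rewrite [X in X + _]big1 => [|u _]; last by rewrite ffunE.
  rewrite big1 ?addr0 // => T /andP[/tabP[_ h _ _] /negP[]].
  by apply/eqP/ffunP=> u; rewrite ffunE; apply: val_inj; apply/eqP; rewrite -leqn0 h.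
rewrite big1 // => T /tabP[h1 h2 _ _]; case: e => i.
rewrite eqn_leq (forallP ml i) andbT leqNgt; apply/negP=> lt.
have jc : (mu i < c)%N by apply: leq_trans lt _.
have := h1 (i, Ordinal jc); have := h2 (i, Ordinal jc); rewrite leqn0 => /eqP ->.
by rewrite /cell /= leqnn lt.
Qed.

End GridTableaux.

Theorem gschur_jtdet (R : comNzRingType) (x : nat -> R) (n N c k : nat) (la mu : nat -> nat) :
  nonincr la -> nonincr mu -> (la 0 <= c)%N -> (forall i, (N <= i)%N -> la i = 0%N) ->
  (k <= n)%N ->
  @gschur R x n N c k la mu = jtdet x k N la mu.
Proof.
move=> hla hmu lac laN; elim: k la hla lac laN => [|k IH] la hla lac laN kn.
  by rewrite jtdet0 // gschur0.
rewrite (jtdetS x k mu hla lac (laN _ (leqnn _))) gschurS //.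
apply: eq_bigr=> nu hnu; congr (_ * _); apply: IH; last exact: ltnW.
- move=> i j ij; case: (ltnP j N) => jN; last by rewrite shape_ge.
  have iN := leq_ltn_trans ij jN.
  rewrite -[i]/(val (Ordinal iN)) -[j]/(val (Ordinal jN)) !shapeE.
  have /andP[_ b1] := forallP hnu (Ordinal jN); have /andP[b2 _] := forallP hnu (Ordinal iN).
  case: (ltngtP i j) ij => // [ij _|e _].
    by apply: leq_trans b1 (leq_trans _ b2); apply: hla.
  by rewrite (_ : Ordinal iN = Ordinal jN) //; apply: val_inj.
- case: (posnP N) => [N0 | N0]; first by rewrite shape_ge // N0.
  by rewrite -[0%N]/(val (Ordinal N0)) shapeE -ltnS.
- by move=> i; apply: shape_ge.
Qed.

(** * Images in the polynomial ring *)

Definition var (n j : nat) : {mpoly int[n]} := if insub j is Some i then 'X_i else 0.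

Lemma varE n (i : 'I_n) : var n i = 'X_i.
Proof. by rewrite /var valK. Qed.

Lemma coef_prod_epoly (R : comNzRingType) (x : nat -> R) m k :
  (\prod_(i < m) (x i *: 'X + 1))`_k = epoly x m k.
Proof.
elim: m k => [|m IH] k; first by rewrite big_ord0 coef1.
rewrite big_ord_recr /= mulrDr mulr1 -scalerAr coefD coefZ coefMX addrC IH.
by case: k => [|k] /=; rewrite ?mulr0 // IH mulrC.
Qed.

Lemma esymE n z : Defs.esym n z = zext (epoly (var n) n) z.
Proof.
case: z => [k|//] /=; rewrite -coef_prod_epoly bigA_distr coef_sum /mesym.
rewrite [LHS]big_mkcond; apply: eq_big => [J|J _]; first by rewrite inE.
rewrite -big_mkcond /= (eq_bigr (fun i => 'X_i *: 'X)) => [|i _]; last by rewrite varE.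
rewrite scaler_prod prodr_const coefZ coefXn eq_sym.
by case: eqP; rewrite ?mulr1 ?mulr0.
Qed.

(** Geometric series truncated at degree [d] do not change the coefficients up
    to [d]. *)
Lemma coef_prod_hpoly (R : comNzRingType) (x : nat -> R) d m k : (k <= d)%N ->
  (\prod_(i < m) \poly_(a < d.+1) x i ^+ a)`_k = hpoly x m k.
Proof.
elim: m k => [|m IH] k kd; first by rewrite big_ord0 coef1.
rewrite big_ord_recr /= coefM; apply: eq_bigr=> i _.
have ik : (i <= k)%N by rewrite -ltnS.
by rewrite IH ?(leq_trans ik) // coef_poly ltnS (leq_trans (leq_subr _ _) kd).
Qed.

(** Expanding the product of the truncated geometric series lists every
    exponent vector with entries at most [d] once. *)
Lemma hsymE n z : hsym n z = zext (hpoly (var n) n) z.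
Proof.
case: z => [d|//] /=; rewrite -(coef_prod_hpoly _ _ (leqnn d)).
under [in RHS]eq_bigr do rewrite poly_def.
rewrite bigA_distr_bigA coef_sum /=.
pose mon (f : {ffun 'I_n -> 'I_d.+1}) : 'X_{1..n} := [multinom f i : nat | i < n].
have coefE (f : {ffun 'I_n -> 'I_d.+1}) :
    (\prod_(i < n) (var n i ^+ f i *: 'X^(f i)))`_d =
    if mdeg (mon f) == d then 'X_[mon f] else 0.
  rewrite scaler_prod coefZ prodrXr coefXn eq_sym mdegE.
  under [in LHS]eq_bigr do rewrite varE.
  rewrite (eq_bigr (fun i => mon f i)) => [|i _]; last by rewrite mnmE.
  rewrite mpolyXE_id; case: eqP => _; rewrite ?mulr0 // mulr1.
  by apply: eq_bigr=> i _; rewrite mnmE.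
under [in RHS]eq_bigr do rewrite coefE.
rewrite -big_mkcond /=.
pose h' (m : 'X_{1..n < d.+1}) : {ffun 'I_n -> 'I_d.+1} := [ffun i => inord (m i)].
rewrite (reindex_omap h' (fun f => insub (mon f))) /=; last first.
  move=> f /eqP df; rewrite insubT ?df //= => lt; congr Some.
  by apply/ffunP=> i; rewrite ffunE; apply: ord_inj; rewrite mnmE inordK.
have monh (m : 'X_{1..n < d.+1}) : mon (h' m) = m.
  apply/mnmP=> i; rewrite mnmE ffunE inordK //.
  by apply: leq_ltn_trans (bmdeg m); rewrite mdegE (bigD1 i) //= leq_addr.
apply: eq_big => [m|m _]; last by rewrite monh.
by rewrite monh (valK m) eqxx andbT.
Qed.

Section GridTransfer.
Variables (n N c : nat) (la mu : seq nat).
Hypotheses (hla : is_partition la).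
Hypotheses (laN : (size la <= N)%N) (muN : (size mu <= N)%N) (lac : (head 0%N la <= c)%N).

Let G := ('I_N * 'I_c)%type.
Definition place (d : skew_cell la mu) : G :=
  (widen_ord laN (val d).1, widen_ord lac (val d).2).

Lemma place_inj : injective place.
Proof.
move=> [[a b] pd] [[a' b'] pe] [e1 e2]; apply: val_inj => /=.
by rewrite (ord_inj e1) (ord_inj e2).
Qed.

Lemma place_cell d : cell (nth 0%N la) (nth 0%N mu) (place d).
Proof. exact: valP d. Qed.

Lemma cell_place (u : G) : cell (nth 0%N la) (nth 0%N mu) u -> exists d, place d = u.
Proof.
case: u => i j; rewrite /cell /= => /andP[mj jl].
have il : (i < size la)%N by rewrite ltnNge; apply/negP=> li; rewrite nth_default in jl.
have jh : (j < head 0%N la)%N.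
  by rewrite -nth0; apply: leq_trans jl (part_nonincr hla _).
have pr : (nth 0 mu (Ordinal il, Ordinal jh).1 <= (Ordinal il, Ordinal jh).2
    < nth 0 la (Ordinal il, Ordinal jh).1)%N by rewrite /= mj jl.
by exists (exist _ (Ordinal il, Ordinal jh) pr); rewrite /place /=; congr (_, _); apply: ord_inj.
Qed.

(** A tableau on the cells of the diagram as one on the grid; [lift ord0] moves
    the letters past the entry 0 reserved for the places outside. *)
Definition extend (T : {ffun skew_cell la mu -> 'I_n}) : {ffun G -> 'I_n.+1} :=
  [ffun u => if [pick d | place d == u] is Some d then lift ord0 (T d) else ord0].

Lemma extend_place T d : extend T (place d) = lift ord0 (T d).
Proof.
rewrite ffunE; case: pickP => [e /eqP/place_inj -> //|/(_ d)].
by rewrite eqxx.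
Qed.

Lemma extend_out T u : ~~ cell (nth 0%N la) (nth 0%N mu) u -> extend T u = ord0.
Proof.
move=> nu; rewrite ffunE; case: pickP => // d /eqP e.
by rewrite -e place_cell in nu.
Qed.

Lemma extend_inj : injective extend.
Proof.
move=> T T' e; apply/ffunP=> d; apply: (@lift_inj _ ord0).
by rewrite -!extend_place e.
Qed.

Lemma tab_extend T :
  tab n (nth 0%N la) (nth 0%N mu) (extend T) = semistandard T.
Proof.
apply/tabP/idP => [[h1 h2 h3 h4] | hT].
  apply/forallP=> d; apply/forallP=> e.
  have cd := place_cell d; have ce := place_cell e.
  apply/andP; split; apply/implyP=> /andP[/eqP ed lt].
    have pe : place e = ((place d).1, (place e).2).
      by apply: injective_projections => //; apply: ord_inj; exact: Logic.eq_sym ed.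
    have pd := surjective_pairing (place d).
    have := h3 (place d).1 (place d).2 (place e).2; rewrite -pe -pd => /(_ cd ce lt).
    by rewrite !extend_place /= /bump /= !add1n ltnS.
  have pe : place e = ((place e).1, (place d).2).
    by apply: injective_projections => //; apply: ord_inj; exact: Logic.eq_sym ed.
  have pd := surjective_pairing (place d).
  have := h4 (place d).1 (place e).1 (place d).2; rewrite -pe -pd => /(_ cd ce lt).
  by rewrite !extend_place /= /bump /= !add1n ltnS.
split=> [u|u|i j1 j2 /cell_place[d ed] /cell_place[e ee] lt|
  i1 i2 j /cell_place[d ed] /cell_place[e ee] lt].
- apply/idP/idP => [/cell_place[d <-]|]; first by rewrite extend_place.
  by apply: contraLR => /extend_out ->.
- by rewrite -ltnS.
- have /forallP/(_ e) /andP[/implyP H _] := forallP hT d.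
  rewrite -ed -ee !extend_place /= /bump /= !add1n ltnS; apply: H.
  have := congr1 (fun u : G => (u.1 : nat, u.2 : nat)) ed => /= -[r1 r2].
  have := congr1 (fun u : G => (u.1 : nat, u.2 : nat)) ee => /= -[r3 r4].
  by rewrite /cell_row /cell_col r1 r2 r3 r4 eqxx.
- have /forallP/(_ e) /andP[_ /implyP H] := forallP hT d.
  rewrite -ed -ee !extend_place /= /bump /= !add1n ltnS; apply: H.
  have := congr1 (fun u : G => (u.1 : nat, u.2 : nat)) ed => /= -[r1 r2].
  have := congr1 (fun u : G => (u.1 : nat, u.2 : nat)) ee => /= -[r3 r4].
  by rewrite /cell_row /cell_col r1 r2 r3 r4 eqxx.
Qed.

Lemma tab_extended T' : tab n (nth 0%N la) (nth 0%N mu) T' -> exists T, T' = extend T.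
Proof.
case/tabP=> h1 _ _ _.
have pf d : ord0 != T' (place d).
  by have := h1 (place d); rewrite place_cell -(inj_eq val_inj) /=; case: (nat_of_ord _).
exists [ffun d => s2val (unlift_some (pf d))]; apply/ffunP=> u.
case: (boolP (cell (nth 0%N la) (nth 0%N mu) u)) => [/cell_place[d <-]|nu].
  by rewrite extend_place ffunE; case: (unlift_some _) => o /= ->.
rewrite extend_out //; have := h1 u; rewrite (negPf nu) => /esym/negbT.
by rewrite -leqNgt leqn0 => /eqP e; apply: val_inj.
Qed.

Lemma weight_extend T : weight (var n) (extend T) = \prod_d 'X_(T d).
Proof.
pose F (u : G) : {mpoly int[n]} := if val (extend T u) is j.+1 then var n j else 1.
transitivity (\prod_(u in [set place d | d in [set: skew_cell la mu]]) F u).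
  rewrite [RHS]big_mkcond; apply: eq_bigr=> u _; case: ifP => // /negbT nu.
  rewrite /F extend_out //; apply: contra nu => /cell_place[d <-].
  by apply: imset_f; rewrite inE.
rewrite big_imset /=; last by move=> d e _ _; apply: place_inj.
apply: eq_big => [d|d _]; first by rewrite inE.
by rewrite /F extend_place /= varE.
Qed.

Lemma skew_schur_gschur :
  skew_schur n la mu = gschur (var n) n N c n (nth 0%N la) (nth 0%N mu).
Proof.
rewrite /skew_schur /gschur.
have -> : part_incl mu la = [forall i : 'I_N, (nth 0 mu i <= nth 0 la i)%N].
  apply/allP/forallP => [h i | h i]; last first.
    rewrite mem_iota add0n /= => im.
    exact: (h (Ordinal (leq_trans im muN))).
  case: (ltnP i (size mu)) => im; last by rewrite nth_default.
  by apply: h; rewrite mem_iota.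
case: ifP => // _.
transitivity (\sum_(T' in [set extend T | T in [set T | semistandard T]]) weight (var n) T').
  rewrite big_imset /=; last by move=> T T' _ _; apply: extend_inj.
  by apply: eq_big => [T|T _]; rewrite ?inE // weight_extend.
apply: eq_bigl => T'; apply/imsetP/idP => [[T] | tT'].
  by rewrite inE => sT ->; rewrite tab_extend.
have [T eT] := tab_extended tT'; exists T => //.
by rewrite inE -tab_extend -eT.
Qed.
End GridTransfer.

(** * The Lascoux-Pragacz formula and its bordered form *)

Lemma eq_lpdet (R : comUnitRingType) q (S H E : nat -> nat -> R) N (a a' b b' : nat -> nat) :
  (forall i, (i < N)%N -> a i = a' i) -> (forall i, (i < N)%N -> b i = b' i) ->
  lpdet q S H E N a b = lpdet q S H E N a' b'.
Proof.
move=> ea eb; congr (_ * \det (block_mx _ _ _ _)); apply/matrixP=> i j;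
  by rewrite !mxE ?ea ?eb.
Qed.

Section FrobeniusDeterminant.
Variables (n : nat) (mu : seq nat).
Hypothesis hmu : is_partition mu.
Let q := durfee mu.
Let S := hookS (var n) n.
Let H a j := zext (hpoly (var n) n) (a%:Z - (nth 0%N (frob_arms mu) j)%:Z).
Let E i b := zext (epoly (var n) n) (b%:Z - (nth 0%N (frob_legs mu) i)%:Z).

(** The grid needs as many rows as both partitions have. When mu is not contained
    in la, both sides vanish. *)
Lemma skew_schur_lpdet (la : seq nat) : is_partition la ->
  skew_schur n la mu =
  lpdet q S H E (durfee la) (nth 0%N (frob_arms la)) (nth 0%N (frob_legs la)).
Proof.
move=> hla; pose N := maxn (size la) (size mu).
have laN : (size la <= N)%N by apply: leq_maxl.
have muN : (size mu <= N)%N by apply: leq_maxr.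
rewrite (skew_schur_gschur n hla laN muN (leqnn _)) gschur_jtdet //.
- exact: jtdet_lpdet.
- exact: part_nonincr.
- exact: part_nonincr.
- by move=> i Ni; rewrite nth_default // (leq_trans laN).
Qed.

End FrobeniusDeterminant.

(** The Lascoux-Pragacz determinant of a hook is its single entry. *)
Lemma schur_hookE n a b : schur n (hook a b) = hookS (var n) n a b.
Proof.
have hh : is_partition (hook a b).
  rewrite /is_partition /hook /= in_cons /= mem_nseq andbF andbT.
  by case: b => //= b; elim: b.
rewrite /schur skew_schur_lpdet //.
have d1 : durfee (hook a b) = 1%N.
  apply/eqP; rewrite eqn_leq durfeeP //= andbT leqNgt durfeeP //=.
  by case: b {hh} => //.
rewrite d1.
rewrite (@eq_lpdet _ _ _ _ _ _ _ (fun=> a) _ (fun=> b)) => [|[|//] _|[|//] _]; last 2 first.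
- by rewrite /frob_arms d1 /= subn1.
- by rewrite /frob_legs d1 /= /conj_part /hook /= count_nseq /= mul1n subn1.
rewrite (_ : durfee [::] = 0%N) // /lpdet mul1r.
rewrite [X in block_mx _ _ X _]flatmx0 det_ublock det_mx00 mulr1 det_mx11.
by rewrite mxE.
Qed.


Section ExtendedSchur.
Variables (n : nat) (mu : seq nat).
Hypothesis hmu : is_partition mu.
Let q := durfee mu.
Let S := hookS (var n) n.
Let H a j := zext (hpoly (var n) n) (a%:Z - (nth 0%N (frob_arms mu) j)%:Z).
Let E i b := zext (epoly (var n) n) (b%:Z - (nth 0%N (frob_legs mu) i)%:Z).

Lemma ext_schur_lpdet (a b : seq nat) :
  ext_schur n a b mu = lpdet q S H E (size a) (nth 0%N a) (nth 0%N b).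
Proof.
rewrite /ext_schur /lpdet; congr (_ * \det _).
congr block_mx; apply/matrixP=> i j; rewrite !mxE.
- exact: schur_hookE.
- exact: hsymE.
- exact: esymE.
Qed.

(** The arms decrease strictly, so the matrix is unitriangular. *)
Lemma det_arms : \det (\matrix_(i < q, j < q) H (nth 0%N (frob_arms mu) i) j) = 1.
Proof.
apply: det_uptrig => [i j ij|i]; rewrite mxE /H.
  by rewrite zext_lt // frob_arms_decr.
by rewrite zext_ge // subnn hpoly0.
Qed.

Lemma det_legs : \det (\matrix_(i < q, j < q) E i (nth 0%N (frob_legs mu) j)) = 1.
Proof.
rewrite -det_tr; apply: det_uptrig => [i j ij|i]; rewrite !mxE /E.
  by rewrite zext_lt // frob_legs_decr.
by rewrite zext_ge // subnn epoly0.
Qed.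

End ExtendedSchur.

Lemma nth_del_nth (s : seq nat) (j i : nat) : (j < size s)%N ->
  nth 0%N (del_nth s j) i = nth 0%N s (bump j i).
Proof.
move=> js; rewrite nth_cat size_take js /bump; case: ltnP => ij.
  by rewrite nth_take // leqNgt ij.
by rewrite nth_drop addSn subnKC // ij.
Qed.

Lemma size_del_nth (s : seq nat) (j : nat) : (j < size s)%N ->
  (size (del_nth s j)).+1 = size s.
Proof. by move=> js; rewrite size_cat size_take js size_drop; lia. Qed.

Theorem theorem4p3 (n : nat) (la mu : seq nat)
    (hla : is_partition la) (hmu : is_partition mu) :
  let p := durfee la in
  let q := durfee mu in
  let alpha := frob_arms la in
  let beta := frob_legs la in
  let gamma := frob_arms mu in
  let delta := frob_legs mu in
  skew_schur n la mu =
  (-1) ^+ q * \det (block_mx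
    (\matrix_(i < p, j < p)
       ext_schur n (nth 0%N alpha i :: gamma) (nth 0%N beta j :: delta) mu)
    (\matrix_(i < p, j < q)
       ext_schur n (nth 0%N alpha i :: del_nth gamma j) delta mu)
    (\matrix_(i < q, j < p)
       ext_schur n gamma (nth 0%N beta j :: del_nth delta i) mu)
    (0 : 'M_q)).
Proof.
cbv zeta.
rewrite (skew_schur_lpdet n hmu hla).
rewrite (bordered_lpdet _ (det_arms n hmu) (det_legs n hmu)).
have szg : size (frob_arms mu) = durfee mu by rewrite size_mkseq.
have szd : size (frob_legs mu) = durfee mu by rewrite size_mkseq.
congr (_ * \det _).
congr block_mx; apply/matrixP=> i j; rewrite !mxE ext_schur_lpdet.
- by rewrite /= szg; apply: eq_lpdet => -[].
- have jq : (j < size (frob_arms mu))%N by rewrite szg.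
  rewrite [size _](size_del_nth jq) szg; apply: eq_lpdet => // -[|k] _ //.
  by rewrite /= nth_del_nth.
- have iq : (i < size (frob_legs mu))%N by rewrite szd.
  rewrite szg; apply: eq_lpdet => // -[|k] _ //.
  by rewrite /= nth_del_nth.
Qed.
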